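(* Let $d\ge2$ and let $C,C_1,C_2,\ldots$ be $d$-dimensional Archimedean copulas with generators $\psi,\psi_1,\psi_2,\ldots$, respectively. If $(C_n)_{n\in\mathbb{N}}$ converges uniformly to $C$, then for any $\ell\in\{1,\ldots,d-1\}$ there exists a set $\Lambda\in\mathcal{B}(\mathbb{I}^\ell)$ with $\mu_{C^{1:\ell}}(\Lambda)=1$ such that for all $\mathbf{x}\in\Lambda$ we have $$\lim_{n\to\infty}K_n(\mathbf{x},[\mathbf{0},\mathbf{y}])=K_\psi(\mathbf{x},[\mathbf{0},\mathbf{y}])$$ for every $\mathbf{y}\in U^{\mathbf{x}}$, where $U^{\mathbf{x}}$ is dense in $\mathbb{I}^{d-\ell}$. Here $K_\psi$ and $K_n$ denote the $\ell$-Markov kernels of $C$ and $C_n$, respectively.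
   Context: Notation: $\mathbb{I}=[0,1]$, $[\mathbf{0},\mathbf{y}]=[0,y_1]\times\cdots\times[0,y_{d-\ell}]$. Archimedean copulas: a generator is a continuous, non-increasing function $\psi:[0,\infty)\to\mathbb{I}$ with $\psi(0)=1$, $\lim_{z\to\infty}\psi(z)=0$, strictly decreasing on $[0,\inf\{z\in[0,\infty]:\psi(z)=0\}]$ (with $\psi(\infty):=0$). $\varphi:(0,1]\to[0,\infty)$ denotes the pseudoinverse of $\psi$, and $\varphi(0):=\inf\{z\in[0,\infty]:\psi(z)=0\}\in(0,\infty]$. A $d$-dimensional copula $C$ is Archimedean with generator $\psi$ if $C(\mathbf{x})=\psi(\varphi(x_1)+\cdots+\varphi(x_d))$ for all $\mathbf{x}\in\mathbb{I}^d$. The right-hand side is a copula if and only if $\psi$ is $d$-monotone: $\psi$ is continuous on $[0,\infty)$, has derivatives $\psi^{(m)}$ up to order $d-2$ on $(0,\infty)$ with $(-1)^m\psi^{(m)}\ge0$ for $m=0,\ldots,d-2$, and $(-1)^{d-2}\psi^{(d-2)}$ is non-increasing and convex on $(0,\infty)$. All generators are normalized so that $\psi(1)=\frac12$. $C^{1:\ell}(\mathbf{x})=C(\mathbf{x},1,\ldots,1)$ for $\mathbf{x}\in\mathbb{I}^\ell$, and $\mu_{C^{1:\ell}}$ is the probability measure on $\mathbb{I}^\ell$ it induces (Lebesgue measure for $\ell=1$). The $\ell$-Markov kernel of a copula $C$ is (a version of) the regular conditional distribution of $(X_{\ell+1},\ldots,X_d)$ given $(X_1,\ldots,X_\ell)$,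 where $(X_1,\ldots,X_d)\sim C$. For Archimedean copulas the following version is used: with $s=\sum_{i=1}^\ell\varphi(x_i)$ and $t=\sum_{j=1}^{d-\ell}\varphi(y_j)$, $K_\psi(\mathbf{x},[\mathbf{0},\mathbf{y}])=1$ if $\min(\mathbf{x})=1$ or $s\ge\varphi(0)$; otherwise $K_\psi(\mathbf{x},[\mathbf{0},\mathbf{y}])=0$ if $s+t>\varphi(0)$ and $K_\psi(\mathbf{x},[\mathbf{0},\mathbf{y}])=\psi^{(\ell)}(s+t)/\psi^{(\ell)}(s)$ if $s+t\le\varphi(0)$. Here $\psi^{(\ell)}(\infty):=0$, and for $\ell=d-1$ the symbol $\psi^{(\ell)}$ means the left-hand derivative $D^-\psi^{(d-2)}$. $K_n$ is given by the same formula with $\psi_n$ and its pseudoinverse $\varphi_n$. *)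

(* Defs.v *)
From HB Require Import structures.
From mathcomp Require Import all_boot all_order all_algebra.
From mathcomp Require Import all_classical all_reals all_analysis.
Set Implicit Arguments.
Unset Strict Implicit.
Unset Printing Implicit Defensive.
Import Order.TTheory GRing.Theory Num.Theory.
Import numFieldTopology.Exports numFieldNormedType.Exports.
Local Open Scope classical_set_scope.
Local Open Scope ring_scope.

(* Random vectors live on n.-tuple R, which carries the product (= Borel)
   sigma-algebra; 'rV[R]_n, which carries the product topology, is used where
   only the topology matters. *)

Definition cube (R : realType) (n : nat) : set (n.-tuple R) :=
  [set x | forall i, 0 <= tnth x i <= 1].

Definition cube_rV (R : realType) (n : nat) : set 'rV[R]_n :=
  [set y | forall i, 0 <= y ord0 i <= 1].

Definition box (R : realType) (n : nat) (x : n.-tuple R) : set (n.-tuple R) :=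
  [set z | forall i, 0 <= tnth z i <= tnth x i].

(* P is the probability measure with distribution function C on the cube;
   since then P (cube n) = C (1, ..., 1), it is the measure induced by C
   as soon as C (1, ..., 1) = 1. *)
Definition induces (R : realType) (n : nat) (C : n.-tuple R -> R)
    (P : probability (n.-tuple (measurableTypeR R)) R) : Prop :=
  forall x : n.-tuple R, cube x -> P (box x) = (C x)%:E.

(* Functions on the closed cube are represented by total functions whose values
   outside the cube are irrelevant. *)
Definition is_copula (R : realType) (n : nat) (C : n.-tuple R -> R) : Prop :=
  exists P : probability (n.-tuple (measurableTypeR R)) R,
    (forall (i : 'I_n) (a : R), 0 <= a <= 1 ->
       P [set z | tnth z i <= a] = a%:E) /\
    induces C P.

(* C^{1:l} (x) = C (x, 1, ..., 1), for l <= d *)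
Definition margin (R : realType) (d l : nat) (C : d.-tuple R -> R)
    (x : l.-tuple R) : R :=
  C [tuple nth 1 x i | i < d].

(* f extended by f(oo) := 0; the value at -oo is never used. *)
Definition ext0 (R : realType) (f : R -> R) (z : \bar R) : R :=
  if z is r%:E then f r else 0.

(* The infimum runs over z in [0, oo], with psi(oo) = 0; for u = 0 this is
   varphi(0), possibly +oo. *)
Definition pseudoinv (R : realType) (psi : R -> R) (u : R) : \bar R :=
  ereal_inf [set z : \bar R | (0 <= z)%E /\ ext0 psi z = u].

(* Only the values of psi on [0, oo[ matter. *)
Record is_generator (R : realType) (psi : R -> R) : Prop := IsGenerator {
  generator_continuous : {within `[0, +oo[, continuous psi} ;
  generator_range : forall z, 0 <= z -> 0 <= psi z <= 1 ;
  generator_nonincreasing : forall y z, 0 <= y -> y <= z -> psi z <= psi y ;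
  generator0 : psi 0 = 1 ;
  generator_cvg : psi z @[z --> +oo] --> (0 : R) ;
  generator_decreasing : forall y z : \bar R,
    (0 <= y)%E -> (y < z)%E -> (z <= pseudoinv psi 0)%E ->
    ext0 psi z < ext0 psi y ;
  generator_normalized : psi 1 = 2^-1 }.

Definition archimedean_copula (R : realType) (d : nat) (psi : R -> R)
    (C : d.-tuple R -> R) : Prop :=
  [/\ is_generator psi, is_copula C &
      forall x : d.-tuple R, cube x ->
        C x = ext0 psi (\sum_(i < d) pseudoinv psi (tnth x i))%E].

Definition left_derive (R : realType) (f : R -> R) (a : R) : R :=
  lim ((f (a + h) - f a) / h @[h --> 0^'-]).

(* psi^(l) for 1 <= l <= d - 1, read as D^- psi^(d-2) when l = d - 1. *)
Definition generator_derive (R : realType) (d l : nat) (psi : R -> R)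
    : R -> R :=
  if l == d.-1 then left_derive (derive1n d.-2 psi) else derive1n l psi.

(* y |-> K_psi (x, [0, y]) *)
Definition markov_kernel (R : realType) (d l : nat) (psi : R -> R)
    (x : l.-tuple R) (y : 'rV[R]_(d - l)) : R :=
  let s := (\sum_(i < l) pseudoinv psi (tnth x i))%E in
  let t := (\sum_(j < d - l) pseudoinv psi (y ord0 j))%E in
  let dpsi := ext0 (generator_derive d l psi) in
  if (\big[Order.min/1]_(i < l) tnth x i == 1) || (pseudoinv psi 0 <= s)%E
  then 1
  else if (pseudoinv psi 0 < s + t)%E then 0
  else dpsi (s + t)%E / dpsi s.

(* Main.v *)
Require Import Defs.
From HB Require Import structures.
From mathcomp Require Import all_boot all_order all_algebra.
From mathcomp Require Import all_classical all_reals all_analysis.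
From mathcomp Require Import measurable_realfun ring lra.
Import Order.TTheory GRing.Theory Num.Theory.
Import numFieldTopology.Exports numFieldNormedType.Exports.
Local Open Scope classical_set_scope.
Local Open Scope ring_scope.

Set Implicit Arguments.
Unset Strict Implicit.
Unset Printing Implicit Defensive.

(** On the scale of the generator, that is in the coordinates phi (x_i), the
    copula is psi (a_1 + ... + a_d): a vector with law C is carried to a vector
    A with P (A_1 >= a_1, ..., A_d >= a_d) = psi (a_1 + ... + a_d).  Everything
    is read off from this survival function.

    Regularity of the generators.  The probabilities of boxes are the mixed
    differences of psi, which are therefore nonnegative up to order d
    ([psi_law_iter_diff]).  For a continuous function this is d-monotonicity,
    stated here with differences ([diff_monotone]) because the derivatives have
    to be produced: a convex function whose decrements f - f (. + h) are convex
    has no kink, and its derivative inherits one order less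
    ([diff_monotone_smooth], [diff_monotone_opp_derive1]).

    Convergence.  The bivariate margins of the C_n converge.  Doubling and
    adding arguments is an operation on copula values, so psi_n converges to
    psi first at the points 2^-k, starting from psi_n (1) = 1/2, then at the
    dyadic numbers, then everywhere by monotonicity ([gen_cvg]); inverting,
    phi_n converges to phi on (0, 1) ([phi_cvg]).  For convex functions
    pointwise convergence forces subgradients to converge wherever the limit
    has only one subgradient ([subgradient_cvg]).  Hence all derivatives of
    order at most d - 2 converge at every point, even along moving arguments,
    and for order d - 1 the left derivatives converge outside the countable set
    N of kinks of psi^(d-2) ([generator_derive_cvg]).

    The kernel.  For x with 0 < s < phi (0), and y in (0, 1)^(d-l), the kernel
    is psi^(l) (s + t) / psi^(l) (s) without case distinction, since psi^(l)
    vanishes beyond phi (0) ([markov_kernelE]); the denominator is nonzero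
    ([generator_derive_neq0]).  So the kernels converge as soon as neither s nor
    s + t lies in N.  As phi is injective, moving one coordinate of y avoids N,
    which gives density ([closure_cube_rV]).

    The exceptional x.  It remains to see that the sum s of the first l < d
    coordinates A_i has no atom and does not reach phi (0)
    ([exceptional_null]).  Requiring A_(l+1) >= r has the same effect on the law
    of (A_1, ..., A_l) as lowering one coordinate by r ([psi_law_shift]),
    because r enters the argument of psi in the same way.  Hence lowering one
    coordinate of a set by r cannot decrease its probability
    ([level_shift_le]).  A level set of positive probability would produce
    infinitely many disjoint sets of at least a fixed positive probability
    ([level_away_null]). *)

(** * Convex functions and subgradients *)

Lemma itv_minus_countable (R : realType) (K : set R) (a b : R) :
  countable K -> a < b -> exists2 u, a < u < b & ~ K u.
Proof.
move=> cK ab; apply: contrapT => H.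
have sub : `]a, b[%classic `<=` K.
  move=> u /=; rewrite in_itv/= => uab; apply: contrapT => nK.
  by apply: H; exists u.
have := countable_lebesgue_measure0 (sub_countable (subset_card_le sub) cK).
rewrite lebesgue_measure_itv/= lte_fin ab => /eqP.
by rewrite -EFinD eqe subr_eq0 => /eqP ba; move: ab; rewrite ba ltxx.
Qed.

Section Subgradients.
Variable R : realType.
Implicit Types (f g : R -> R) (x y z p q : R).

Definition convex_pos f := forall x y z, 0 < x -> x < y -> y < z ->
  (f y - f x) * (z - y) <= (f z - f y) * (y - x).

Definition subgradient f x p := forall z, 0 < z -> f x + p * (z - x) <= f z.

(** For a convex function this is differentiability at x.  Uniqueness of the
    subgradient expresses it by inequalities alone, without a limit. *)
Definition smooth_at f x := forall p q,
  subgradient f x p -> subgradient f x q -> p = q.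

(** By convexity the slopes of the chords ending at x increase as their left end
    approaches x and stay below the slopes of the chords starting at x: they
    converge to their supremum, which separates the two families. *)
Lemma left_derive_lim f x : 0 < x -> convex_pos f ->
  (f (x + h) - f x) / h @[h --> 0^'-] --> left_derive f x /\
  subgradient f x (left_derive f x).
Proof.
move=> x0 cf.
pose S := [set (f x - f y) / (x - y) | y in [set y | 0 < y < x]].
have ubS z : x < z -> ubound S ((f z - f x) / (z - x)).
  move=> xz _ [y /andP[y0 yx] <-].
  rewrite ler_pdivrMr ?subr_gt0// mulrAC ler_pdivlMr ?subr_gt0//.
  exact: cf.
have mono y y' : 0 < y -> y < y' -> y' < x ->
    (f x - f y) / (x - y) <= (f x - f y') / (x - y').
  move=> y0 yy' y'x; have := cf _ _ _ y0 yy' y'x.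
  rewrite ler_pdivrMr ?subr_gt0 ?(lt_trans yy')// mulrAC.
  rewrite ler_pdivlMr ?subr_gt0//; move=> ?; nra.
have hS : has_sup S.
  split; first by exists ((f x - f (x / 2)) / (x - x / 2)), (x / 2) => //=; lra.
  by exists ((f (x + 1) - f x) / (x + 1 - x)); apply: ubS; lra.
have leL y : 0 < y < x -> (f x - f y) / (x - y) <= sup S.
  by move=> yx; apply: ub_le_sup; [case: hS|exists y].
have cvgL : (f (x + h) - f x) / h @[h --> 0^'-] --> sup S.
  apply/cvgrPdist_lt => e e0.
  have [_ [y /andP[y0 yx] <-] ylt] := sup_adherent e0 hS.
  near=> h.
  have h0 : h < 0 by near: h; exact: nbhs_left_lt.
  have yh : y - x < h by near: h; apply: nbhs_left_gt; lra.
  have m := mono y (x + h) y0 ltac:(lra) ltac:(lra).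
  have l := leL (x + h) ltac:(apply/andP; split; lra).
  have E : (f x - f (x + h)) / (x - (x + h)) = (f (x + h) - f x) / h.
    by field; lra.
  rewrite E in m l; rewrite ger0_norm; lra.
have -> : left_derive f x = sup S by exact: cvg_lim cvgL.
split=> // z z0; have [zx|xz|->] := ltgtP z x; last by lra.
- have := leL z ltac:(lra); rewrite ler_pdivrMr ?subr_gt0//; lra.
- have : sup S <= (f z - f x) / (z - x).
    by apply: ge_sup; [case: hS|exact: ubS].
  rewrite ler_pdivlMr ?subr_gt0//; lra.
Unshelve. all: by end_near. Qed.

(** If all chords starting at x had slope at least p + e, then p + e would be a
    second subgradient. *)
Lemma subgradient_above f x p : 0 < x -> subgradient f x p -> smooth_at f x ->
  forall e, 0 < e -> exists2 z, x < z & f z < f x + (p + e) * (z - x).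
Proof.
move=> x0 sp sm e e0; apply: contrapT => H.
suff : p = p + e by lra.
apply: sm => // z z0; have [zx|xz|->] := ltgtP z x; last by lra.
- have := sp z z0; nra.
- by rewrite leNgt; apply/negP => L; apply: H; exists z.
Qed.

Lemma subgradient_below f x p : 0 < x -> subgradient f x p -> smooth_at f x ->
  forall e, 0 < e ->
  exists2 z, 0 < z < x & f z < f x + (p - e) * (z - x).
Proof.
move=> x0 sp sm e e0; apply: contrapT => H.
suff : p = p - e by lra.
apply: sm => // z z0; have [zx|xz|->] := ltgtP z x; last by lra.
- by rewrite leNgt; apply/negP => L; apply: H; exists z => //; rewrite z0.
- have := sp z z0; nra.
Qed.

(** The difference quotient is squeezed between p and the slope of a chord,
    which [subgradient_above] and [subgradient_below] bring within e of p. *)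
Lemma smooth_derive f x p : 0 < x -> convex_pos f -> smooth_at f x ->
  subgradient f x p -> is_derive x 1 f p.
Proof.
move=> x0 cf sm sp.
have cv : h^-1 *: (f (h *: 1 + x) - f x) @[h --> 0^'] --> p.
  apply/cvgrPdist_lt => e e0.
  have [z xz fz] := subgradient_above x0 sp sm e0.
  have [y /andP[y0 yx] fy] := subgradient_below x0 sp sm e0.
  near=> h.
  have h0 : h != 0 by near: h; exact: nbhs_dnbhs_neq.
  have hz : `|h| < z - x.
    by near: h; apply: dnbhs0_lt; rewrite subr_gt0.
  have hy : `|h| < x - y.
    by near: h; apply: dnbhs0_lt; rewrite subr_gt0.
  have -> : h *: 1 + x = x + h by rewrite [h *: 1]mulr1 addrC.
  rewrite [_ *: _]mulrC.
  have [hp|hn] : 0 < h \/ h < 0 by have := lt_total h0; case/orP; tauto.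
  - rewrite gtr0_norm// in hz.
    have s1 := sp (x + h) ltac:(lra).
    have c := cf x (x + h) z x0 ltac:(lra) ltac:(lra).
    rewrite ltr_distlC; apply/andP; split.
      rewrite ltr_pdivlMr//; nra.
    rewrite ltr_pdivrMr//; nra.
  - rewrite ltr0_norm// in hy.
    have s1 := sp (x + h) ltac:(lra).
    have c := cf y (x + h) x y0 ltac:(lra) ltac:(lra).
    rewrite ltr_distlC; apply/andP; split.
      rewrite ltr_ndivlMr//; nra.
    rewrite ltr_ndivrMr//; nra.
by split; [apply/cvg_ex; exists p|exact: cvg_lim cv].
Unshelve. all: by end_near. Qed.

(** A subgradient of F n at X n is at most the slope of the chord from X n to a
    point z > x; these slopes converge to the slope of the limit function, which
    is close to p for a good z.  Points on the left give the lower bound. *)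
Lemma subgradient_cvg (F : nat -> R -> R) f (X : nat -> R) x (P : nat -> R) p :
  0 < x -> (forall z, 0 < z -> F n z @[n --> \oo] --> f z) ->
  X n @[n --> \oo] --> x -> F n (X n) @[n --> \oo] --> f x ->
  (forall n, 0 < X n -> subgradient (F n) (X n) (P n)) ->
  smooth_at f x -> subgradient f x p -> P n @[n --> \oo] --> p.
Proof.
move=> x0 Ff Xx FXf FP sm sp; apply/cvgrPdist_lt => e e0.
have [z xz fz] := subgradient_above x0 sp sm e0.
have [y /andP[y0 yx] fy] := subgradient_below x0 sp sm e0.
have lim_at t q : 0 < t ->
    F n t - F n (X n) - q * (t - X n) @[n --> \oo] --> f t - f x - q * (t - x).
  move=> t0; apply: cvgB; first by apply: cvgB => //; exact: Ff.
  by apply: cvgM; [exact: cvg_cst|apply: cvgB => //; exact: cvg_cst].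
have lz := lim_at z (p + e) ltac:(lra).
have ly := lim_at y (p - e) y0.
near=> n.
have Xy : y < X n by near: n; apply: (cvgr_gt x).
have Xz : X n < z by near: n; apply: (cvgr_lt x).
have Lz : F n z - F n (X n) - (p + e) * (z - X n) < 0.
  by near: n; apply: (cvgr_lt _ lz); lra.
have Ly : F n y - F n (X n) - (p - e) * (y - X n) < 0.
  by near: n; apply: (cvgr_lt _ ly); lra.
have X0 : 0 < X n by lra.
have sz := FP n X0 z ltac:(lra).
have sy := FP n X0 y y0.
rewrite ltr_distl; apply/andP; split; nra.
Unshelve. all: by end_near. Qed.

(** At a kink choose a rational m strictly between two subgradients.  Then x is
    the strict minimiser of z |-> f z - m z, so m determines x. *)
Lemma countable_kinks f : countable [set x | 0 < x /\ ~ smooth_at f x].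
Proof.
pose S x := [set m : rat | forall z, 0 < z -> z != x ->
  f x - ratr m * x < f z - ratr m * z].
pose r x := xget 0 (S x).
have rP x : 0 < x -> ~ smooth_at f x -> S x (r x).
  move=> x0 ns; suff : exists m, S x m by move=> /(xgetPex 0).
  have [p [q [sp [sq pq]]]] : exists p q,
      subgradient f x p /\ subgradient f x q /\ p < q.
    apply: contrapT => H; apply: ns => p q sp sq.
    have [pq|qp|//] := ltgtP p q; exfalso; apply: H.
      by exists p, q.
    by exists q, p.
  have /rat_in_itvoo[m] := pq; rewrite in_itv/= => /andP[pm mq].
  exists m => z z0 zx; have := sp z z0; have := sq z z0.
  have [zx'|xz|E] := ltgtP z x; [nra|nra|by rewrite E eqxx in zx].
apply/countable_injP; exists (fun x => pickle (r x)) => x y.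
rewrite !inE => -[x0 kx] [y0 ky] /(pcan_inj pickleK)/= E.
apply/eqP/negPn/negP => xy.
have := rP x x0 kx y y0; rewrite eq_sym => /(_ xy).
by have := rP y y0 ky x x0 xy; rewrite E => /lt_trans h /h; rewrite ltxx.
Qed.

End Subgradients.

(** * Monotonicity of higher order through differences *)

Section DifferenceMonotone.
Variable R : realType.
Implicit Types (f g : R -> R) (x y z p q h : R).

Definition convex_decr f := [/\ forall x, 0 < x -> 0 <= f x,
  forall x y, 0 < x -> x <= y -> f y <= f x & convex_pos f].

(** This is (k + 2)-monotonicity on (0, oo), with decrements in the place of
    derivatives: no derivative has to exist beforehand, and the class is closed
    under pointwise limits. *)
Fixpoint diff_monotone (k : nat) f : Prop :=
  convex_decr f /\ if k is k'.+1 then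
    forall h, 0 < h -> diff_monotone k' (fun x => f x - f (x + h)) else True.

Lemma diff_monotone_convex_decr k f : diff_monotone k f -> convex_decr f.
Proof. by case: k => [|k] []. Qed.

Lemma diff_monotone_scale k c f :
  0 <= c -> diff_monotone k f -> diff_monotone k (fun x => c * f x).
Proof.
move=> c0; have dc g : convex_decr g -> convex_decr (fun x => c * g x).
  case=> [g0 gd gc]; split=> [x x0|x y x0 xy|x y z x0 xy yz].
  - by rewrite mulr_ge0// g0.
  - by rewrite ler_wpM2l// gd.
  - by have := gc _ _ _ x0 xy yz; rewrite -!mulrBr -!mulrA; exact: ler_wpM2l.
elim: k f => [|k IH] f [fd fh]; split; try exact: dc; first by [].
move=> h h0; have := IH _ (fh _ h0); congr diff_monotone.
by apply: funext => x; rewrite mulrBr.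
Qed.

Lemma diff_monotone_lim k (F : nat -> R -> R) f :
  (forall n, diff_monotone k (F n)) ->
  (forall x, 0 < x -> F n x @[n --> \oo] --> f x) -> diff_monotone k f.
Proof.
have dl (G : nat -> R -> R) g : (forall n, convex_decr (G n)) ->
    (forall x, 0 < x -> G n x @[n --> \oo] --> g x) -> convex_decr g.
  move=> Gd Gg; split=> [x x0|x y x0 xy|x y z x0 xy yz].
  - apply: (cvgr_to_ge (Gg x x0)); near=> n; by have [] := Gd n => + _ _; apply.
  - have y0 : 0 < y by lra.
    apply: (ler_cvg_to (Gg y y0) (Gg x x0)); near=> n.
    by have [] := Gd n => _ + _; apply.
  - have y0 : 0 < y by lra.
    have z0 : 0 < z by lra.
    have lim3 a b c : 0 < a -> 0 < b ->
        (G n a - G n b) * c @[n --> \oo] --> (g a - g b) * c.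
      move=> a0 b0.
      by apply: cvgM; [apply: cvgB; exact: Gg|exact: cvg_cst].
    apply: (ler_cvg_to (lim3 y x (z - y) y0 x0) (lim3 z y (y - x) z0 y0)).
    by near=> n; have [_ _ c] := Gd n; exact: (c x y z).
elim: k F f => [|k IH] F f Fc Ff;
    have fd := dl _ _ (fun n => diff_monotone_convex_decr (Fc n)) Ff.
  by split.
split=> //.
move=> h h0; apply: (IH (fun n x => F n x - F n (x + h))).
  by move=> n; have [_] := Fc n; apply.
by move=> x x0; apply: cvgB; apply: Ff => //; lra.
Unshelve. all: by end_near. Qed.

Lemma diff_monotone_eq k f g : (forall x, 0 < x -> f x = g x) ->
  diff_monotone k f -> diff_monotone k g.
Proof.
move=> fg fc; apply: (@diff_monotone_lim _ (fun=> f)) => // x x0.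
by rewrite fg//; exact: cvg_cst.
Qed.

(** If f has two subgradients p, q at x, add to them a subgradient at y < x of
    the convex function f - f (. + (x - y)): this gives two subgradients of f
    at y.  So every point of (0, x) would be a kink, but there are only
    countably many. *)
Lemma diff_monotone_smooth k f x :
  diff_monotone k.+1 f -> 0 < x -> smooth_at f x.
Proof.
move=> fc x0; apply: contrapT => ns.
have [p [q [sp [sq pq]]]] : exists p q,
    subgradient f x p /\ subgradient f x q /\ p <> q.
  apply: contrapT => H; apply: ns => p q sp sq.
  by apply: contrapT => pq; apply: H; exists p, q.
have [y /andP[y0 yx] nky] := itv_minus_countable (countable_kinks f) x0.
apply: nky; split=> // sm; have [_ gh] := fc.
have /diff_monotone_convex_decr[_ _ gc] := gh (x - y) ltac:(lra).
have [_ sr] := left_derive_lim y0 gc; set r := left_derive _ _ in sr.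
have tr t : subgradient f x t -> subgradient f y (r + t).
  move=> st z z0; have := sr z z0; have := st (z + (x - y)) ltac:(lra).
  by rewrite subrKC; lra.
by apply: pq; have := sm _ _ (tr _ sp) (tr _ sq); lra.
Qed.

Lemma diff_monotone_derive k f x : diff_monotone k.+1 f -> 0 < x ->
  is_derive x 1 f (derive1 f x) /\ subgradient f x (derive1 f x).
Proof.
move=> fc x0; have [_ _ cf] := diff_monotone_convex_decr fc.
have [_ sp] := left_derive_lim x0 cf.
have D := smooth_derive x0 cf (diff_monotone_smooth fc x0) sp.
by rewrite derive1E derive_val.
Qed.

(** - f' is the pointwise limit of the scaled decrements n (f - f (. + 1/n)). *)
Lemma diff_monotone_opp_derive1 k f :
  diff_monotone k.+1 f -> diff_monotone k (fun x => - derive1 f x).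
Proof.
move=> fc; have [_ fh] := fc.
pose F n x := n.+1%:R * (f x - f (x + n.+1%:R^-1)).
apply: (@diff_monotone_lim _ F) => [n|x x0].
  by apply: diff_monotone_scale => //; apply: fh; rewrite invr_gt0.
have [[cv Dv] _] := diff_monotone_derive fc x0.
move: cv => /cvg_ex[l cv].
have El : derive1 f x = l by rewrite -Dv; exact: cvg_lim cv.
have -> : F ^~ x = fun n =>
    - ((n.+1%:R^-1)^-1 *: (f (n.+1%:R^-1 *: 1 + x) - f x)).
  apply: funext => n; rewrite /F invrK [_%:R^-1 *: 1]mulr1 [_^-1 + x]addrC.
  by rewrite -mulrN opprB.
rewrite El; apply: cvgN; move/cvgr_dnbhsP : cv => /(_ (@harmonic R)); apply.
by split=> [n|]; [rewrite gt_eqF//= invr_gt0|exact: cvg_harmonic].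
Qed.

Definition alt_derive f j x := (-1) ^+ j * derive1n j f x.

Lemma derive1n_alt f j : derive1n j f = fun x => (-1) ^+ j * alt_derive f j x.
Proof. by apply: funext => x; rewrite /alt_derive signrMK. Qed.

Lemma derive1_scale f c x : derivable f x 1 ->
  derive1 (fun z => c * f z) x = c * derive1 f x.
Proof. by move=> df; rewrite !derive1E (deriveZ c df). Qed.

Lemma left_derive_scale f c x : 0 < x -> convex_pos f ->
  left_derive (fun z => c * f z) x = c * left_derive f x.
Proof.
move=> x0 cf; have [cv _] := left_derive_lim x0 cf.
apply: cvg_lim => //; rewrite -/(left_derive _ _).
under eq_fun do rewrite -mulrBr -mulrA.
by apply: cvgM => //; exact: cvg_cst.
Qed.

Lemma alt_derive_monotone k f j : (j <= k)%N -> diff_monotone k f ->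
  diff_monotone (k - j) (alt_derive f j) /\
  ((j < k)%N -> forall x, 0 < x ->
      alt_derive f j.+1 x = - derive1 (alt_derive f j) x).
Proof.
move=> jk fc.
have step i : (i < k)%N -> diff_monotone (k - i) (alt_derive f i) ->
      forall x, 0 < x -> alt_derive f i.+1 x = - derive1 (alt_derive f i) x.
  move=> ik ic x x0; rewrite [LHS]/alt_derive derive1nS derive1n_alt.
  have ki : (k - i)%N = (k - i).-1.+1 by rewrite prednK ?subn_gt0.
  rewrite ki in ic; have [[dv _] _] := diff_monotone_derive ic x0.
  by rewrite derive1_scale// exprS -mulrA signrMK mulN1r.
suff ic : diff_monotone (k - j) (alt_derive f j) by split=> // jk'; exact: step.
elim: j jk => [|j IH] jk.
  rewrite subn0 (_ : alt_derive f 0 = f)//; apply: funext => x.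
  by rewrite /alt_derive expr0 mul1r.
have jc := IH (ltnW jk).
rewrite subnS; have := @diff_monotone_opp_derive1 (k - j).-1 (alt_derive f j).
rewrite prednK ?subn_gt0// => /(_ jc); apply: diff_monotone_eq => x x0.
by rewrite step.
Qed.

(** The limit is continuous at x, so there are y < x < z where it is close to
    f x; monotonicity of F n traps F n (X n) between F n z and F n y. *)
Lemma convex_decr_cvg (F : nat -> R -> R) f (X : nat -> R) x :
  (forall n, convex_decr (F n)) -> convex_decr f ->
  (forall z, 0 < z -> F n z @[n --> \oo] --> f z) -> 0 < x ->
  X n @[n --> \oo] --> x -> F n (X n) @[n --> \oo] --> f x.
Proof.
move=> Fd [_ fd fc] Ff x0 Xx; apply/cvgrPdist_lt => e e0.
have [_ sp] := left_derive_lim x0 fc; set p := left_derive _ _ in sp.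
(* right continuity of f: the subgradient p bounds f from below *)
have [z xz fz] : exists2 z, x < z & f x - e / 2 < f z.
  have p1 : 0 < `|p| + 1 by have := normr_ge0 p; lra.
  pose t := e / 2 / (`|p| + 1).
  have t0 : 0 < t by rewrite divr_gt0//; lra.
  have tp : t * (`|p| + 1) = e / 2 by rewrite divfK// gt_eqF.
  exists (x + t); first lra.
  apply: lt_le_trans (sp (x + t) ltac:(lra)).
  rewrite (_ : x + t - x = t); last by ring.
  have := ler_norm (- p); rewrite normrN; nra.
(* left continuity of f: the chord from x / 2 to x bounds f from above *)
have [y /andP[y0 yx] fy] : exists2 y, 0 < y < x & f y < f x + e / 2.
  pose c := f (x / 2) - f x.
  have c0 : 0 <= c by rewrite subr_ge0; apply: fd; lra.
  pose t := e / 2 / (c + e).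
  have t0 : 0 < t by rewrite !divr_gt0//; lra.
  have t1 : t < 1 by rewrite ltr_pdivrMr; lra.
  have tx0 : 0 < t * (x / 2) by rewrite mulr_gt0//; lra.
  have tx : t * (x / 2) < x / 2 by rewrite gtr_pMl//; lra.
  have tc : t * (c + e) = e / 2 by rewrite divfK//; lra.
  exists (x - t * (x / 2)); first by apply/andP; split; lra.
  have := fc (x / 2) (x - t * (x / 2)) x ltac:(lra) ltac:(lra) ltac:(lra).
  have -> : x - (x - t * (x / 2)) = t * (x / 2) by ring.
  have -> : x - t * (x / 2) - x / 2 = (1 - t) * (x / 2) by field.
  move: (f (x - _)) => w.
  rewrite [leLHS]mulrA [leRHS]mulrA ler_pM2r; last lra.
  move=> cw; have : t * c < e / 2 by rewrite -tc ltr_pM2l//; lra.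
  by rewrite /c; nra.
have z0 : 0 < z by lra.
near=> n.
have Xy : y < X n by near: n; apply: (cvgr_gt x).
have Xz : X n < z by near: n; apply: (cvgr_lt x).
have Fy : F n y < f x + e / 2 by near: n; apply: (cvgr_lt _ (Ff y y0)).
have Fz : f x - e / 2 < F n z.
  by near: n; apply: (cvgr_gt _ (Ff z z0)).
have [_ dn _] := Fd n.
have h1 := dn y (X n) y0 (ltW Xy).
have h2 := dn (X n) z ltac:(lra) (ltW Xz).
by rewrite ltr_distlC; apply/andP; split; lra.
Unshelve. all: by end_near. Qed.

Lemma alt_derive_cvg k (F : nat -> R -> R) f j : (j <= k)%N ->
  (forall n, diff_monotone k (F n)) -> diff_monotone k f ->
  (forall z, 0 < z -> F n z @[n --> \oo] --> f z) ->
  forall z, 0 < z -> alt_derive (F n) j z @[n --> \oo] --> alt_derive f j z.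
Proof.
move=> jk Fc fc Ff; elim: j jk => [|j IH] jk z z0.
  rewrite /alt_derive; under eq_fun do rewrite expr0 mul1r.
  by rewrite expr0 mul1r; exact: Ff.
have [gc ->//] := alt_derive_monotone (ltnW jk) fc.
have kj : (k - j)%N = (k - j).-1.+1 by rewrite prednK ?subn_gt0.
rewrite kj in gc.
under eq_fun => n do rewrite (alt_derive_monotone (ltnW jk) (Fc n)).2//.
have Gc n : diff_monotone (k - j).-1.+1 (alt_derive (F n) j).
  by rewrite -kj; exact: (alt_derive_monotone (ltnW jk) (Fc n)).1.
apply: cvgN; apply: (@subgradient_cvg _ (fun n => alt_derive (F n) j)
  (alt_derive f j) (fun=> z) z) => //.
- exact: IH (ltnW jk).
- exact: cvg_cst.
- exact: IH (ltnW jk) _ z0.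
- by move=> n _; exact: (diff_monotone_derive (Gc n) z0).2.
- exact: diff_monotone_smooth gc z0.
- exact: (diff_monotone_derive gc z0).2.
Qed.

(** A subgradient 0 at s means that the nonincreasing function alt_derive f j is
    constant on [s, oo).  By induction on j this is impossible: the function of
    order j - 1 would be affine with negative slope, yet it is nonnegative; and
    for j = 0 the constant would be the limit 0.  A zero of alt_derive f j at s
    is a subgradient 0 of the function of order j - 1. *)
Lemma alt_derive_pos k f j s : (j <= k)%N -> diff_monotone k f ->
  0 < s -> 0 < f s ->
  f z @[z --> +oo] --> 0 ->
  0 < alt_derive f j s /\ ~ subgradient (alt_derive f j) s 0.
Proof.
move=> jk fc s0 fs f0; elim: j jk => [|j IH] jk.
  have -> : alt_derive f 0 = f.
    by apply: funext => x; rewrite /alt_derive expr0 mul1r.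
  split=> // sg; suff : f s <= 0 by lra.
  apply: (cvgr_to_ge f0); near=> z.
  have z0 : 0 < z by near: z; exact: nbhs_pinfty_gt.
  have := sg z z0.
  by rewrite mul0r addr0.
have [jp jn] := IH (ltnW jk).
have [gc E] := alt_derive_monotone (ltnW jk) fc.
have {}E := E jk.
have [gc' _] := alt_derive_monotone jk fc.
have kj : (k - j)%N = (k - j).-1.+1 by rewrite prednK ?subn_gt0.
rewrite kj in gc.
have [p' d' _] := diff_monotone_convex_decr gc'.
have [p d _] := diff_monotone_convex_decr gc.
have gt0 : 0 < alt_derive f j.+1 s.
  rewrite lt_neqAle p'// andbT eq_sym; apply/eqP => E0; apply: jn.
  have [_] := diff_monotone_derive gc s0.
  by rewrite -[derive1 _ _]opprK -E// E0 oppr0.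
split=> // sg; set K := alt_derive f j.+1 s in gt0.
(* slopes at most - K beyond s would make alt_derive f j negative at z *)
pose z := s + (alt_derive f j s + 1) / K.
have sz : s < z by rewrite ltrDl divr_gt0//; lra.
have z0 : 0 < z by lra.
have [_] := diff_monotone_derive gc z0.
rewrite -[derive1 _ _]opprK -E// => /(_ s s0).
have := p z z0; have := sg z z0; rewrite mul0r addr0 -/K.
have : (z - s) * K = alt_derive f j s + 1.
  by rewrite /z addrAC subrr add0r divfK// gt_eqF.
nra.
Unshelve. all: by end_near. Qed.

End DifferenceMonotone.

(** * Generators and their pseudoinverses *)

Section Generators.
Variables (R : realType) (psi : R -> R).
Hypothesis G : is_generator psi.
Implicit Types (a b x y z u q : R).

Lemma gen_ge0 z : 0 <= z -> 0 <= psi z.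
Proof. by move=> /(generator_range G)/andP[]. Qed.

Lemma gen_le1 z : 0 <= z -> psi z <= 1.
Proof. by move=> /(generator_range G)/andP[]. Qed.

Lemma gen_itv a : 0 <= a -> 0 < psi a -> 0 < psi a <= 1.
Proof. by move=> a0 ->; rewrite gen_le1. Qed.

Lemma gen_continuous x : 0 < x -> {for x, continuous psi}.
Proof.
move=> x0; have := generator_continuous G => /continuous_within_itvcyP[+ _].
by apply; rewrite in_itv/= x0.
Qed.

Lemma gen_surj u : 0 < u <= 1 -> exists2 a, 0 <= a & psi a = u.
Proof.
move=> /andP[u0 u1].
have [b [b0 bu]] : exists b, 0 < b /\ psi b < u.
  near (pinfty_nbhs R) => b; exists b; split.
    by near: b; exact: nbhs_pinfty_gt.
  by near: b; apply: (cvgr_lt _ (generator_cvg G)).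
have cw : {within `[0, b], continuous psi}.
  apply: continuous_subspaceW (generator_continuous G).
  by move=> z /=; rewrite !in_itv/= andbT => /andP[].
have [||a] := @IVT _ psi 0 b u _ cw; first exact: ltW.
  by rewrite (generator0 G) ge_min le_max u1 (ltW bu) orbT.
by rewrite in_itv/= => /andP[a0 _] <-; exists a.
Unshelve. all: by end_near. Qed.

Lemma pseudoinv_ge0 u : (0 <= pseudoinv psi u)%E.
Proof. by apply: le_ereal_inf_tmp => z []. Qed.

(** By continuity psi takes the value psi z / 2 at some a > z, and every zero of
    psi lies beyond a; so the infimum is at least a. *)
Lemma lt_pseudoinv0 z : 0 <= z -> 0 < psi z -> (z%:E < pseudoinv psi 0)%E.
Proof.
move=> z0 pz.
have [|a a0 pa] := @gen_surj (psi z / 2); first by have := gen_le1 z0; lra.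
have za : z < a.
  rewrite ltNge; apply/negP => /(generator_nonincreasing G a0); lra.
apply: (@lt_le_trans _ _ a%:E); first by rewrite lte_fin.
apply: le_ereal_inf_tmp; case=> [r| |] [//=]; rewrite ?lee_fin ?leey// => r0 pr.
rewrite leNgt; apply/negP => ra.
by have := generator_nonincreasing G r0 (ltW ra); lra.
Qed.

Lemma pseudoinv0_le z : 0 <= z -> psi z = 0 -> (pseudoinv psi 0 <= z%:E)%E.
Proof. by move=> z0 pz; apply: ereal_inf_lbound; split. Qed.

Lemma gen_gt0 z : 0 <= z -> (0 < psi z) = (z%:E < pseudoinv psi 0)%E.
Proof.
move=> z0; apply/idP/idP; first exact: lt_pseudoinv0.
rewrite ltNge => /negP h; rewrite lt_neqAle gen_ge0// andbT eq_sym.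
by apply/eqP => /(pseudoinv0_le z0).
Qed.

Lemma ext0_gen_eq0 (z : \bar R) : (pseudoinv psi 0 <= z)%E -> ext0 psi z = 0.
Proof.
case: z => [z| |]//= h.
have z0 : 0 <= z by rewrite -lee_fin (le_trans (pseudoinv_ge0 _) h).
apply/eqP; rewrite eq_le gen_ge0// andbT leNgt gen_gt0//.
by rewrite ltNge h.
Qed.

Lemma gen_lt y z : 0 <= y -> y < z -> 0 < psi y -> psi z < psi y.
Proof.
move=> y0 yz py; have z0 : 0 <= z by lra.
have [pz|] := ltP 0 (psi z); last lra.
apply: (generator_decreasing G (y := y%:E) (z := z%:E));
  rewrite ?lee_fin ?lte_fin//.
by apply: ltW; rewrite -gen_gt0.
Qed.

Lemma pseudoinvK a : 0 <= a -> 0 < psi a -> pseudoinv psi (psi a) = a%:E.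
Proof.
move=> a0 pa; rewrite /pseudoinv -[RHS]ereal_inf1; congr ereal_inf.
apply/seteqP; split=> [[r| |] [//= + E]|z ->]; first last.
- by split; rewrite ?lee_fin.
- by move=> _; move: pa; rewrite -E ltxx.
rewrite lee_fin => r0; have [ra|ar|->//] := ltgtP r a.
  by have := gen_lt r0 ra; rewrite E => /(_ pa); rewrite ltxx.
by have := gen_lt a0 ar pa; rewrite E ltxx.
Qed.

(** The pseudoinverse as a real function.  Outside (0, 1] the value 0 keeps it
    nonnegative and measurable; these points have probability 0. *)
Definition phi u := if 0 < u <= 1 then fine (pseudoinv psi u) else 0.

Lemma phi_ge0 u : 0 <= phi u.
Proof.
by rewrite /phi; case: ifP => // _; apply: fine_ge0; exact: pseudoinv_ge0.
Qed.

Lemma phiK a : 0 <= a -> 0 < psi a -> phi (psi a) = a.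
Proof. by move=> a0 pa; rewrite /phi gen_itv// pseudoinvK. Qed.

Lemma phi_psi u : 0 < u <= 1 -> psi (phi u) = u.
Proof.
by move=> /[dup] u01 /gen_surj[a a0 E]; rewrite -E phiK// E; case/andP: u01.
Qed.

Lemma pseudoinvE u : 0 < u <= 1 -> pseudoinv psi u = (phi u)%:E.
Proof.
move=> /[dup] u01 /gen_surj[a a0 E].
have p : 0 < psi a by rewrite E; case/andP: u01.
by rewrite -E phiK// pseudoinvK.
Qed.

Lemma le_phi q u : 0 <= q -> 0 < u <= 1 -> (q <= phi u) = (u <= psi q).
Proof.
move=> q0 u01; have Eu := phi_psi u01; rewrite -[X in _ = (X <= _)]Eu.
apply/idP/idP => [|]; first exact: generator_nonincreasing.
apply: contraTT; rewrite -!ltNge => uq.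
apply: gen_lt => //; first exact: phi_ge0.
by rewrite Eu; case/andP: u01.
Qed.

Lemma measurable_phi :
  measurable_fun setT (phi : measurableTypeR R -> measurableTypeR R).
Proof.
apply: (measurability (@RGenCInfty.G R)); first exact: RGenCInfty.measurableE.
move=> _ [_ [q ->] <-]; rewrite setTI.
have [q0|q0] := ltP 0 q; last first.
  rewrite (_ : _ @^-1` _ = setT)//; apply/seteqP; split=> // u _ /=.
  by rewrite in_itv/= andbT (le_trans q0)// phi_ge0.
rewrite (_ : _ @^-1` _ = `]0, psi q]%classic)//; apply/seteqP; split=> u /=.
  rewrite !in_itv/= andbT => qu.
  have u01 : 0 < u <= 1.
    by move: qu; rewrite /phi; case: ifP => // _; rewrite leNgt q0.
  by case/andP: (u01) => -> _ /=; rewrite -le_phi// ltW.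
rewrite !in_itv/= andbT => /andP[u0 uq].
by rewrite le_phi ?(ltW q0)// u0 (le_trans uq)// gen_le1// ltW.
Qed.

(** When some psi (a_i) = 0, its pseudoinverse is phi (0), possibly smaller than
    a_i; both sides are 0 in that case. *)
Lemma archimedean_psi d (C : d.-tuple R -> R) (a : 'I_d -> R) :
  archimedean_copula psi C -> (forall i, 0 <= a i) ->
  C [tuple psi (a i) | i < d] = psi (\sum_i a i).
Proof.
move=> [_ _ CE] a0; rewrite CE; last first.
  by move=> i; rewrite tnth_mktuple gen_ge0// gen_le1.
under eq_bigr do rewrite tnth_mktuple.
have [/forallP ap|] := boolP [forall i, 0 < psi (a i)].
  by under eq_bigr do rewrite pseudoinvK//; rewrite sumEFin.
rewrite negb_forall => /existsP[i]; rewrite -leNgt => ai.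
have Ei : psi (a i) = 0 by apply/eqP; rewrite eq_le ai gen_ge0.
have le_sum : a i <= \sum_j a j by rewrite (bigD1 i)//= lerDl sumr_ge0.
rewrite ext0_gen_eq0; last first.
  by rewrite (bigD1 i)//= Ei leeDl// sume_ge0// => j _; exact: pseudoinv_ge0.
apply/eqP; rewrite eq_le gen_ge0 ?sumr_ge0//=.
by rewrite -[leRHS]Ei; exact: (generator_nonincreasing G).
Qed.

End Generators.

(** * The law of an Archimedean copula on the scale of its generator *)

Section TupleMeasurability.
Variables (R : realType) (n : nat).
Local Notation T := (n.-tuple (measurableTypeR R)).

Lemma measurable_tnth_preimage i (B : set (measurableTypeR R)) :
  measurable B -> measurable [set z : T | B (tnth z i)].
Proof.
by move=> mB; rewrite -[X in measurable X]setTI; exact: measurable_tnth.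
Qed.

Lemma measurable_forall (I : finType) (B : I -> set T) :
  (forall i, measurable (B i)) -> measurable [set z | forall i, B i z].
Proof.
move=> mB; rewrite (_ : [set z | _] = \bigcap_(i in setT) B i).
  by apply: fin_bigcap_measurable => //; exact: finite_finset.
by apply/seteqP; split=> z /= Bz; [move=> i _|move=> i]; exact: Bz.
Qed.

End TupleMeasurability.

Lemma negligible_exists d (T : sigmaRingType d) (R : realFieldType)
    (mu : {measure set T -> \bar R}) (I : countType) (F : I -> set T) :
  (forall i, mu.-negligible (F i)) -> mu.-negligible [set z | exists i, F i z].
Proof.
move=> NF; pose F' k := if unpickle k is Some i then F i else set0.
apply: (@negligibleS _ _ _ _ (\bigcup_k F' k)).
  by move=> z [i Fz]; exists (pickle i) => //; rewrite /F' pickleK.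
apply: negligible_bigcup => k; rewrite /F'.
by case: unpickle => [i|]; [exact: NF|exact: negligible_set0].
Qed.

Section Law.
Variables (R : realType) (psi : R -> R) (G : is_generator psi).
Local Notation phi := (phi psi).

(** The form shared, in every dimension, by the measures of the copula and of
    its margins. *)
Definition psi_law n (Q : probability (n.-tuple (measurableTypeR R)) R) :=
  forall a : 'I_n -> R, (forall i, 0 <= a i) ->
    Q (box [tuple psi (a i) | i < n]) = (psi (\sum_i a i))%:E.

Lemma cube_psi n (a : 'I_n -> R) : (forall i, 0 <= a i) ->
  cube [tuple psi (a i) | i < n].
Proof.
by move=> a0 i; rewrite tnth_mktuple (gen_ge0 G)//= (gen_le1 G).
Qed.

Lemma psi_law_copula d (C : d.-tuple R -> R) : archimedean_copula psi C ->
  exists P, @psi_law d P.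
Proof.
move=> /[dup] aC [_ [P [_ PC]] _]; exists P => a a0.
by rewrite PC; [rewrite (archimedean_psi G aC)|exact: cube_psi].
Qed.

(** The coordinates 1 added by the margin are psi 0, and contribute 0 to the
    sum. *)
Lemma psi_law_margin d l (C : d.-tuple R -> R) mu : (l <= d)%N ->
  archimedean_copula psi C -> induces (@margin R d l C) mu -> psi_law mu.
Proof.
move=> ld aC muC a a0; rewrite muC; last exact: cube_psi.
pose b (i : nat) := if insub i is Some j then a j else 0.
have b0 i : 0 <= b i by rewrite /b; case: insubP.
have -> : margin C [tuple psi (a i) | i < l] = C [tuple psi (b i) | i < d].
  congr C; apply: eq_from_tnth => i; rewrite !tnth_mktuple /b.
  case: insubP => [j _ ji|]; last first.
    by rewrite -leqNgt => li; rewrite nth_default ?(generator0 G)// size_tuple.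
  by rewrite -ji -tnth_nth tnth_mktuple.
rewrite (archimedean_psi G aC)//; congr (psi _)%:E.
rewrite [RHS](eq_bigr (fun i : 'I_l => b (val i))); last first.
  by move=> i _; rewrite /b valK.
rewrite (big_ord_widen _ b ld) [RHS]big_mkcond/=; apply: eq_bigr => i _.
by case: ifPn => //; rewrite /b; case: insubP => // j -> _ /negP.
Qed.

Section Support.
Variables (n : nat) (Q : probability (n.-tuple (measurableTypeR R)) R).
Hypothesis lawQ : psi_law Q.
Local Notation T := (n.-tuple (measurableTypeR R)).

Definition pos_cube : set T := [set z | forall i, 0 < tnth z i <= 1].

Lemma measurable_box (x : T) : measurable (box x : set T).
Proof.
apply: measurable_forall => i.
apply: (@measurable_tnth_preimage _ _ i `[0, tnth x i]%classic).
exact: measurable_itv.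
Qed.

Lemma measurable_pos_cube : measurable pos_cube.
Proof.
apply: measurable_forall => i.
apply: (@measurable_tnth_preimage _ _ i `]0, 1]%classic).
exact: measurable_itv.
Qed.

(** The points of the cube with z_i <= 0 lie in boxes of measure psi a for every
    a > 0, and psi vanishes at infinity. *)
Lemma psi_law_pos_cube : Q (~` pos_cube) = 0%E.
Proof.
pose ones : T := [tuple psi 0 | i < n].
have Q1 : Q (box ones) = 1%E.
  by rewrite (lawQ (fun=> lexx 0)) big1// (generator0 G).
pose Z i : set T := [set z | box ones z /\ tnth z i <= 0].
have mZ i : measurable (Z i).
  apply: measurableI; first exact: measurable_box.
  apply: (@measurable_tnth_preimage _ _ i `]-oo, 0]%classic).
  exact: measurable_itv.
have Z0 i : Q (Z i) = 0%E.
  apply/eqP; rewrite eq_le measure_ge0 andbT; apply/lee_addgt0Pr => e e0.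
  have [a [a0 ae]] : exists a, 0 < a /\ psi a < e.
    near (pinfty_nbhs R) => a; exists a; split.
      by near: a; exact: nbhs_pinfty_gt.
    by near: a; apply: (cvgr_lt _ (generator_cvg G)).
  pose b j := if j == i then a else 0.
  have b0 j : 0 <= b j by rewrite /b; case: ifP => // _; exact: ltW.
  have Eb : \sum_j b j = a.
    by rewrite (bigD1 i)//= {1}/b eqxx big1 ?addr0// /b => j /negbTE ->.
  have sub : Z i `<=` box [tuple psi (b i) | i < n].
    move=> z [zb zi] j; have := zb j; rewrite !tnth_mktuple /b.
    case: eqP => [->|_] // /andP[-> _]/=.
    by rewrite (le_trans zi)// (gen_ge0 G)// ltW.
  apply: (@le_trans _ _ (psi a)%:E); last by rewrite add0e lee_fin ltW.
  rewrite -Eb -lawQ//; apply: le_measure; rewrite ?inE//.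
  exact: measurable_box.
apply: measure_negligible.
  by apply: measurableC; exact: measurable_pos_cube.
have nZ : Q.-negligible [set z | exists i, Z i z].
  by apply: negligible_exists => i; apply/negligibleP; [exact: mZ|exact: Z0].
have nb : Q.-negligible (~` box ones).
  apply/negligibleP; first by apply: measurableC; exact: measurable_box.
  suff : Q (~` box ones) = 0%E by [].
  by rewrite (probability_setC Q (measurable_box ones)) Q1 subee.
apply: negligibleS (negligibleU nb nZ) => z nz.
have [zb|] := pselect (box ones z); [right|by left].
apply: contrapT => nZz; apply: nz => i; have := zb i.
rewrite tnth_mktuple (generator0 G) => /andP[_ ->]; rewrite andbT ltNge.
by apply/negP => zi; apply: nZz; exists i.
Unshelve. all: by end_near. Qed.

Lemma measurable_orthant (q : 'I_n -> R) :
  measurable [set z : T | forall i, q i <= phi (tnth z i)].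
Proof.
apply: measurable_forall => i.
apply: (@measurable_tnth_preimage _ _ i [set u | q i <= phi u]).
rewrite (_ : [set u | _] = setT `&` phi @^-1` `[q i, +oo[%classic).
  by apply: (measurable_phi G) => //; exact: measurable_itv.
by rewrite setTI; apply/seteqP; split=> u /=; rewrite in_itv/= andbT.
Qed.

(** On (0, 1]^n, phi reverses the order, so the orthant and the box differ by a
    null set. *)
Lemma psi_law_orthant (q : 'I_n -> R) : (forall i, 0 <= q i) ->
  Q [set z | forall i, q i <= phi (tnth z i)] = (psi (\sum_i q i))%:E.
Proof.
move=> q0; rewrite -lawQ//.
have E (A : set T) : measurable A -> Q A = Q (A `&` pos_cube).
  move=> mA; rewrite -[in LHS](setUIDK A pos_cube) measureU0//.
  - by apply: measurableI => //; exact: measurable_pos_cube.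
  - by apply: measurableD => //; exact: measurable_pos_cube.
  - apply: measure_negligible.
      by apply: measurableD => //; exact: measurable_pos_cube.
    apply: (@negligibleS _ _ _ _ (~` pos_cube)); first by move=> z [].
    apply/negligibleP; last exact: psi_law_pos_cube.
    by apply: measurableC; exact: measurable_pos_cube.
rewrite (E _ (measurable_orthant q)) (E _ (measurable_box _)).
congr (Q _); apply/seteqP; split=> z [zq zp]; split=> // i.
  have := zq i; rewrite (le_phi G)// tnth_mktuple => ->.
  by have /andP[/ltW -> _] := zp i.
by have := zq i; rewrite (le_phi G)// tnth_mktuple => /andP[].
Qed.

End Support.
End Law.

(** * From box probabilities to monotonicity of the generator *)

Section Differences.
Variable R : realType.
Implicit Types (f : R -> R) (h : nat -> R) (x y z : R).

(** The mixed difference of order k with steps h 0, ..., h (k - 1), multiplied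
    by (-1)^k. *)
Fixpoint iter_diff h k f x :=
  if k is k'.+1 then iter_diff h k' f x - iter_diff h k' f (x + h k') else f x.

Lemma iter_diffSl h t k f x :
  iter_diff (fun i => if i is i'.+1 then h i' else t) k.+1 f x =
  iter_diff h k (fun y => f y - f (y + t)) x.
Proof.
elim: k x => [//|k IH] x; rewrite [RHS]/= -!IH.
by rewrite [LHS]/=.
Qed.

(** Let c maximise f minus its chord over [x, z].  If the maximum were positive,
    the midpoint inequality centred at c, with the distance from c to the nearer
    end as step, would bound twice the maximum by the maximum itself. *)
Lemma midpoint_convex_pos f : (forall x, 0 < x -> {for x, continuous f}) ->
  (forall x (h : R), 0 < x -> 0 < h -> f (x + h) *+ 2 <= f x + f (x + h + h)) ->
  convex_pos f.
Proof.
move=> cf mf x y z x0 xy yz.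
pose s := (f z - f x) / (z - x).
pose g w := f w - f x - s * (w - x).
have xz : x < z by lra.
have gz : g z = 0 by rewrite /g /s divfK ?subrr// gt_eqF// subr_gt0.
have gx : g x = 0 by rewrite /g !subrr mulr0 subrr.
have cg : {within `[x, z], continuous g}.
  apply: continuous_in_subspaceT => w; rewrite inE/= in_itv/= => /andP[xw wz].
  apply: cvgB; first by apply: cvgB; [apply: cf; lra|exact: cvg_cst].
  by apply: cvgM; [exact: cvg_cst|apply: cvgB; [exact: cvg_id|exact: cvg_cst]].
have [c /[!in_itv]/= /andP[xc cz] cmax] := EVT_max (ltW xz) cg.
have gc : g c <= 0.
  rewrite leNgt; apply/negP => gc0.
  have {}xc : x < c.
    rewrite lt_neqAle xc andbT; apply/eqP => E.
    by rewrite -E gx ltxx in gc0.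
  have {}cz : c < z.
    rewrite lt_neqAle cz andbT; apply/eqP => E.
    by rewrite E gz ltxx in gc0.
  have mg t (h : R) : 0 < t -> 0 < h -> g (t + h) *+ 2 <= g t + g (t + h + h).
    by move=> t0 h0; have := mf t h t0 h0; rewrite /g !mulr2n; lra.
  have [cl|cr] := leP (c - x) (z - c).
    have := mg x (c - x) x0 ltac:(lra); rewrite subrKC.
    have := cmax (c + (c - x)); rewrite in_itv/= gx mulr2n.
    by move=> /(_ ltac:(apply/andP; split; lra)); lra.
  have := mg (c - (z - c)) (z - c) ltac:(lra) ltac:(lra).
  rewrite (_ : c - (z - c) + (z - c) = c); last by ring.
  rewrite (_ : c + (z - c) = z); last by ring.
  have := cmax (c - (z - c)); rewrite in_itv/= gz mulr2n.
  by move=> /(_ ltac:(apply/andP; split; lra)); lra.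
have {}gc : g y <= 0.
  by apply: le_trans gc; apply: cmax; rewrite in_itv/= !ltW.
have sE : s * (z - x) = f z - f x by rewrite /s divfK// gt_eqF// subr_gt0.
rewrite /g in gc; nra.
Qed.

(** Differences of order 0, 1 and 2 give a nonnegative nonincreasing convex
    function; the higher ones say the same of the decrements. *)
Lemma iter_diff_monotone n f : (forall x, 0 < x -> {for x, continuous f}) ->
  (forall k h x, (k <= n.+2)%N -> (forall i, 0 <= h i) -> 0 < x ->
     0 <= iter_diff h k f x) -> diff_monotone n f.
Proof.
have base g : (forall x, 0 < x -> {for x, continuous g}) ->
  (forall k h x, (k <= 2)%N -> (forall i, 0 <= h i) -> 0 < x ->
     0 <= iter_diff h k g x) -> convex_decr g.
  move=> cg dg; split=> [x x0|x y x0 xy|].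
  - exact: (dg 0%N (fun=> 0)).
  - have yx0 (i : nat) : 0 <= y - x by rewrite subr_ge0.
    by have := dg 1%N (fun=> y - x) x isT yx0 x0; rewrite /= subrKC subr_ge0.
  - apply: midpoint_convex_pos => // x h x0 h0.
    have := dg 2%N (fun=> h) x isT (fun=> ltW h0) x0.
    by rewrite /= mulr2n; lra.
elim: n f => [|n IH] f cf df.
  by split=> //; exact: base.
split; first by apply: base => // k h x k2; apply: df; exact: leq_trans k2 _.
move=> h0 h0p; apply: IH => [x x0|k h x kn hp x0].
  apply: cvgB; first exact: cf.
  apply: (@cvg_comp _ _ _ (fun y => y + h0) f _ (nbhs (x + h0)));
    last by apply: cf; lra.
  by apply: cvgD; [exact: cvg_id|exact: cvg_cst].
by rewrite -iter_diffSl; apply: df => // -[|i]//; exact: ltW.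
Qed.

End Differences.

Section LawMonotone.
Variables (R : realType) (psi : R -> R) (G : is_generator psi).
Local Notation phi := (phi psi).
Variables (n : nat) (Q : probability (n.-tuple (measurableTypeR R)) R).
Hypothesis lawQ : psi_law psi Q.
Local Notation T := (n.-tuple (measurableTypeR R)).

(** Bounding one more coordinate from above removes from the event its translate
    by h k in that coordinate, which is one more difference. *)
Lemma psi_law_iter_diff k (a : 'I_n -> R) (h : nat -> R) : (k <= n)%N ->
  (forall i, 0 <= a i) -> (forall i, 0 <= h i) ->
  Q [set z : T | forall i : 'I_n, a i <= phi (tnth z i) /\
       ((i < k)%N -> phi (tnth z i) < a i + h i)] =
  (iter_diff h k psi (\sum_i a i))%:E.
Proof.
pose Ev k (a : 'I_n -> R) : set T := [set z | forall i : 'I_n,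
  a i <= phi (tnth z i) /\ ((i < k)%N -> phi (tnth z i) < a i + h i)].
rewrite -/(Ev k a).
have mphi (B : set R) i : measurable (B : set (measurableTypeR R)) ->
    measurable [set z : T | B (phi (tnth z i))].
  move=> mB; apply: (@measurable_tnth_preimage _ _ i [set u | B (phi u)]).
  by have := measurable_phi G measurableT mB; rewrite setTI.
have mEv j b : measurable (Ev j b).
  apply: measurable_forall => i.
  have [ij|ji] := ltnP i j.
    rewrite [X in measurable X](_ : _ =
        [set z | `[b i, b i + h i[%classic (phi (tnth z i))]).
      by apply: mphi; exact: measurable_itv.
    apply/seteqP; split=> z /=; rewrite in_itv/=.
      by move=> [-> ->].
    by move=> /andP[].
  rewrite [X in measurable X](_ : _ =
      [set z | `[b i, +oo[%classic (phi (tnth z i))]).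
    by apply: mphi; exact: measurable_itv.
  apply/seteqP; split=> z /=; rewrite in_itv/= andbT; first by case.
  by [].
move=> + + h0; elim: k a => [|k IH] a kn a0.
  rewrite /= -(psi_law_orthant G lawQ)//; congr (Q _); apply/seteqP.
  by split=> z zq i; have := zq i => //; case.
pose ik : 'I_n := Ordinal kn.
pose b i := if i == ik then a i + h k else a i.
have b0 i : 0 <= b i by rewrite /b; case: ifP => _; rewrite ?addr_ge0.
have sb : \sum_i b i = \sum_i a i + h k.
  rewrite (bigD1 ik)//= [in RHS](bigD1 ik)//= /b eqxx addrAC; congr (_ + _ + _).
  by apply: eq_bigr => i /negbTE ->.
have sub : Ev k b `<=` Ev k a.
  move=> z zb i; have := zb i; rewrite /b; case: eqP => [->|//] [l _].
  by split; [apply: le_trans l; rewrite lerDl|rewrite ltnn].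
have -> : Ev k.+1 a = Ev k a `\` Ev k b.
  apply/seteqP; split=> z.
    move=> za; split=> [i|zb].
      by have [l u] := za i; split=> // ik'; apply: u; exact: ltnW.
    have [_ /(_ (ltnSn k))] := za ik; have [+ _] := zb ik.
    by rewrite /b eqxx /= => /le_lt_trans h1 /h1; rewrite ltxx.
  move=> [za nzb] i; have [l u] := za i; split=> //; rewrite ltnS leq_eqVlt.
  case/orP => [/eqP ek|]; last exact: u.
  have eik : i = ik by exact: val_inj.
  rewrite ltNge; apply/negP => le; apply: nzb => j; rewrite /b.
  case: eqP => [->|_]; last exact: za.
  by split; [rewrite -eik -ek|rewrite ltnn].
have -> : Q (Ev k a `\` Ev k b) = (Q (Ev k a) - Q (Ev k b))%E.
  rewrite measureD//; first by rewrite setIidr.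
  by rewrite (le_lt_trans (probability_le1 _ _))// ltry.
by rewrite !IH ?(ltnW kn)// sb.
Qed.

Lemma psi_law_diff_monotone m : n = m.+2 -> diff_monotone m psi.
Proof.
move=> nm; apply: iter_diff_monotone => [x x0|k h x kn h0 x0].
  exact: gen_continuous.
rewrite -nm in kn; have n0 : (0 < n)%N by rewrite nm.
pose a (i : 'I_n) := if i == Ordinal n0 then x else 0.
have a0 i : 0 <= a i by rewrite /a; case: ifP => // _; exact: ltW.
have sa : \sum_i a i = x.
  rewrite (bigD1 (Ordinal n0))//= {1}/a eqxx big1 ?addr0// /a.
  by move=> j /negbTE ->.
by rewrite -lee_fin -sa -psi_law_iter_diff.
Qed.

End LawMonotone.

(** * The sum of the first coordinates has no atom *)

Section OrthantUniqueness.
Variables (R : realType) (n : nat).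
Local Notation T := (n.-tuple (measurableTypeR R)).

Definition orthant (q : 'I_n -> R) : set T :=
  [set a | forall i, q i <= tnth a i].

Definition orthants : set (set T) := [set A | exists q, A = orthant q].

Lemma nat_bound (a : 'I_n -> R) : exists k : nat, forall i, - k%:R <= a i.
Proof.
exists (Num.trunc (\sum_i `|a i|)).+1 => i.
rewrite lerNl; apply: le_trans (ltW (truncnS_gt _)).
rewrite (bigD1 i)//= (le_trans (ler_norm _))// normrN lerDl.
by apply: sumr_ge0.
Qed.

Lemma setI_closed_orthants : setI_closed orthants.
Proof.
move=> _ _ [p ->] [q ->]; exists (fun i => Num.max (p i) (q i)).
apply/seteqP; split=> a /=.
  by move=> [pa qa] i; rewrite ge_max pa qa.
by move=> pqa; split=> i; have := pqa i; rewrite ge_max => /andP[].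
Qed.

Lemma measurable_orthants : @measurable _ T = <<s orthants >>.
Proof.
apply/seteqP; split; last first.
  apply: smallest_sub; first exact: sigma_algebra_measurable.
  move=> _ [q ->]; apply: measurable_forall => i.
  apply: (@measurable_tnth_preimage _ _ i [set u | q i <= u]).
  rewrite (_ : [set u | _] = `[q i, +oo[%classic); first exact: measurable_itv.
  by apply/seteqP; split=> u /=; rewrite in_itv/= andbT.
apply: smallest_sub; first exact: smallest_sigma_algebra.
rewrite -bigcup_seq => A [/= i _] [B mB <-].
suff : measurable_fun [set: g_sigma_algebraType orthants]
    (fun z : g_sigma_algebraType orthants =>
      (@tnth n R z i : measurableTypeR R)).
  by move=> /(_ measurableT _ mB).
apply: (measurability (@RGenCInfty.G R)); first exact: RGenCInfty.measurableE.
move=> _ [_ [q ->] <-]; rewrite setTI.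
rewrite (_ : _ @^-1` _ =
    \bigcup_k orthant (fun j => if j == i then q else - k%:R)).
  by apply: bigcupT_measurable => k; apply: sub_sigma_algebra; eexists.
apply/seteqP; split=> z /=; rewrite in_itv/= andbT.
  move=> qz; have [k kz] := nat_bound (tnth z).
  by exists k => // j; case: eqP => [->//|_]; exact: kz.
by move=> [k _ /(_ i)]; rewrite eqxx.
Qed.

Lemma orthant_unique (m1 m2 : {measure set T -> \bar R}) :
  (m1 setT < +oo)%E -> (forall q, m1 (orthant q) = m2 (orthant q)) ->
  forall A, measurable A -> m1 A = m2 A.
Proof.
move=> m1oo m12 A mA.
pose g k := orthant (fun=> - k%:R).
apply: (measure_unique orthants g) => //.
- exact: measurable_orthants.
- exact: setI_closed_orthants.
- by move=> k; eexists.
- apply/seteqP; split=> // a _; have [k ka] := nat_bound (tnth a).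
  by exists k.
- by move=> _ [q ->].
- move=> k; apply: le_lt_trans m1oo; apply: le_measure; rewrite ?inE//.
  by rewrite measurable_orthants; apply: sub_sigma_algebra; eexists.
Qed.

End OrthantUniqueness.

Lemma image_measure_on d d' (T1 : measurableType d) (T2 : measurableType d')
    (R : realType) (m : {measure set T1 -> \bar R}) (D : set T1)
    (f : T1 -> T2) : measurable D -> measurable_fun setT f ->
  exists m' : {measure set T2 -> \bar R}, forall A, m' A = m (f @^-1` A `&` D).
Proof.
move=> mD mf.
by exists (measure_function_pushforward__canonical__measure_function_Measure
  (mrestr m mD) mf).
Qed.

Lemma sum_ord_widen0 (V : nmodType) (F : nat -> V) m n : (m <= n)%N ->
  (forall j, (m <= j)%N -> F j = 0) -> \sum_(j < n) F j = \sum_(j < m) F j.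
Proof.
move=> mn F0; rewrite (big_ord_widen _ F mn) [RHS]big_mkcond/=.
by apply: eq_bigr => j _; case: ltnP => // /F0.
Qed.

Section NullSets.
Variables (R : realType) (psi : R -> R) (G : is_generator psi).
Local Notation phi := (phi psi).
Variables (d l : nat) (ld : (l < d)%N).
Variables (P : probability (d.-tuple (measurableTypeR R)) R)
  (mu : probability (l.-tuple (measurableTypeR R)) R).
Hypotheses (lawP : psi_law psi P) (lawmu : psi_law psi mu).
Local Notation T := (l.-tuple (measurableTypeR R)).

Definition phi_sum (z : T) : R := \sum_i phi (tnth z i).

Lemma measurable_phi_tnth n (i : 'I_n) :
  measurable_fun [set: n.-tuple (measurableTypeR R)]
    (fun z => phi (tnth z i) : measurableTypeR R).
Proof. exact: measurableT_comp (measurable_phi G) (measurable_tnth i). Qed.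

Lemma measurable_phi_sum :
  measurable_fun [set: T] (phi_sum : T -> measurableTypeR R).
Proof. by apply: measurable_sum => i; exact: measurable_phi_tnth. Qed.

Lemma measurable_phi_ge n (i : 'I_n) r :
  measurable [set z : n.-tuple (measurableTypeR R) | r <= phi (tnth z i)].
Proof.
rewrite (_ : [set z | _] =
    setT `&` (fun z => phi (tnth z i)) @^-1` `[r, +oo[%classic).
  by apply: measurable_phi_tnth => //; exact: measurable_itv.
by rewrite setTI; apply/seteqP; split=> z /=; rewrite in_itv/= andbT.
Qed.

Definition shift_phi (i0 : 'I_l) (r : R) (z : T) : T :=
  [tuple phi (tnth z i) - (if i == i0 then r else 0) | i < l].

Lemma measurable_shift_phi i0 r : measurable_fun [set: T] (shift_phi i0 r).
Proof.
apply/measurable_fun_tnthP => i.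
rewrite (_ : _ \o _ = fun z : T => phi (tnth z i) - (if i == i0 then r else 0)).
  by apply: measurable_funB; [exact: measurable_phi_tnth|exact: measurable_cst].
by apply: funext => z /=; rewrite tnth_mktuple.
Qed.

Definition head_phi (z : d.-tuple (measurableTypeR R)) : T :=
  [tuple phi (tnth z (widen_ord (ltnW ld) i)) | i < l].

Lemma measurable_head_phi : measurable_fun setT head_phi.
Proof.
apply/measurable_fun_tnthP => i.
rewrite (_ : _ \o _ = fun z => phi (tnth z (widen_ord (ltnW ld) i))).
  exact: measurable_phi_tnth.
by apply: funext => z /=; rewrite tnth_mktuple.
Qed.

(** Both sides are finite measures in B.  On the orthant with corner q >= 0 they
    are equal to psi (q_1 + ... + q_l + r): adding r to one argument of psi, or
    requiring one more coordinate to be at least r, has the same effect. *)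
Lemma psi_law_shift i0 r B : 0 <= r -> measurable B ->
  mu (shift_phi i0 r @^-1` B `&` [set z | r <= phi (tnth z i0)]) =
  P (head_phi @^-1` B `&` [set z | r <= phi (tnth z (Ordinal ld))]).
Proof.
move=> r0 mB.
have [m1 E1] := image_measure_on mu (measurable_phi_ge i0 r)
  (measurable_shift_phi i0 r).
have [m2 E2] := image_measure_on P (measurable_phi_ge (Ordinal ld) r)
  measurable_head_phi.
rewrite -E1 -E2; apply: orthant_unique => // [|q].
  rewrite E1 (le_lt_trans (probability_le1 _ _)) ?ltry//.
  rewrite preimage_setT setTI; exact: measurable_phi_ge.
(* phi is nonnegative, so negative corners can be replaced by 0 *)
pose p i := Num.max (q i) 0.
have p0 i : 0 <= p i by rewrite le_max lexx orbT.
pose pr i := p i + (if i == i0 then r else 0).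
have pr0 i : 0 <= pr i by rewrite addr_ge0//; case: ifP.
have -> : m1 (orthant q) = (psi (\sum_i p i + r))%:E.
  have -> : \sum_i p i + r = \sum_i pr i.
    by rewrite big_split/= -big_mkcond/= big_pred1_eq.
  rewrite -(psi_law_orthant G lawmu pr0) E1; congr (mu _); apply/seteqP; split.
    move=> z [/= zq zr] i; have := zq i.
    rewrite tnth_mktuple lerBrDr /pr /p maxr_absE.
    case: (eqVneq i i0) => [->|_]; rewrite -maxr_absE;
      case: (leP (q _) 0); rewrite ?add0r ?addr0 //.
    by rewrite (phi_ge0 psi).
  move=> z zp; split=> [i|] /=.
    rewrite tnth_mktuple lerBrDr; apply: le_trans (zp i).
    by rewrite /pr lerD2r le_max lexx.
  by apply: le_trans (zp i0); rewrite /pr eqxx lerDr.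
pose b j := if insub j is Some i then p i else if j == l then r else 0.
have b0 j : 0 <= b j by rewrite /b; case: insubP => [//|_]; case: ifP.
have bi (i : 'I_l) : b i = p i by rewrite /b valK.
have bl : b l = r by rewrite /b insubF ?ltnn// eqxx.
have bge j : (l < j)%N -> b j = 0.
  by move=> lj; rewrite /b insubF ?ltnNge ?(ltnW lj)//= gtn_eqF.
have <- : \sum_(j < d) b j = \sum_i p i + r.
  rewrite (sum_ord_widen0 ld)// big_ord_recr/= bl; congr (_ + _).
  by apply: eq_bigr => i _; rewrite bi.
rewrite -(psi_law_orthant G lawP (fun j => b0 j)) E2; congr (P _).
apply/seteqP; split=> z.
  move=> zb; split=> [i|] /=; last by have := zb (Ordinal ld); rewrite /= bl.
  rewrite tnth_mktuple; apply: le_trans (zb (widen_ord (ltnW ld) i)).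
  by rewrite /= bi le_max lexx.
move=> [/= zq zr] j; have [jl|lj|jl] := ltngtP j l.
- have := zq (Ordinal jl); rewrite tnth_mktuple.
  rewrite (_ : widen_ord _ _ = j); last exact: val_inj.
  move=> qj; have := bi (Ordinal jl); rewrite /= => ->.
  by rewrite /p ge_max qj (phi_ge0 psi).
- by rewrite bge// (phi_ge0 psi).
- by rewrite jl bl; rewrite (_ : j = Ordinal ld)//; exact: val_inj.
Qed.

(** The right-hand side of [psi_law_shift] decreases in r, and r = 0 is the law
    itself. *)
Lemma shift_phi_le i0 r B : 0 <= r -> measurable B ->
  (mu (shift_phi i0 r @^-1` B `&` [set z | (r <= phi (tnth z i0))%R]) <=
   mu (shift_phi i0 0 @^-1` B))%E.
Proof.
move=> r0 mB; rewrite psi_law_shift//.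
have -> : shift_phi i0 0 @^-1` B =
    shift_phi i0 0 @^-1` B `&` [set z | 0 <= phi (tnth z i0)].
  by apply/seteqP; split=> [z Bz|z [//]]; split=> //=; exact: phi_ge0.
rewrite psi_law_shift//; apply: le_measure; rewrite ?inE.
- apply: measurableI; last exact: measurable_phi_ge.
  by rewrite -[X in measurable X]setTI; exact: measurable_head_phi.
- apply: measurableI; last exact: measurable_phi_ge.
  by rewrite -[X in measurable X]setTI; exact: measurable_head_phi.
- by move=> z [Bz _]; split=> //=; exact: phi_ge0.
Qed.

Lemma measurable_phi_sum_level c : measurable [set z : T | phi_sum z = c].
Proof.
rewrite (_ : [set z | _] = setT `&` phi_sum @^-1` [set c]).
  by apply: measurable_phi_sum => //; exact: measurable_set1.
by rewrite setTI.
Qed.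

Lemma sum_shift i0 r (z : T) :
  \sum_i tnth (shift_phi i0 r z) i = phi_sum z - r.
Proof.
under eq_bigr do rewrite tnth_mktuple.
rewrite sumrB; congr (_ - _).
by rewrite -big_mkcond/= big_pred1_eq.
Qed.

Lemma level_shift_le i0 r c e : 0 <= r <= e ->
  (mu [set z | phi_sum z = c /\ (e <= phi (tnth z i0))%R]
   <= mu [set z | phi_sum z = (c - r)%R])%E.
Proof.
move=> /andP[r0 re].
pose B : set T := [set a | \sum_i tnth a i = c - r].
have mB : measurable B.
  rewrite (_ : B = setT `&`
      (fun a : T => \sum_i tnth a i : measurableTypeR R) @^-1` [set c - r]).
    have mS : measurable_fun [set: T]
        (fun a : T => \sum_i tnth a i : measurableTypeR R).
      by apply: measurable_sum => i; exact: measurable_tnth.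
    by apply: mS => //; exact: measurable_set1.
  by rewrite setTI.
have := shift_phi_le i0 r0 mB.
have -> : shift_phi i0 0 @^-1` B = [set z | phi_sum z = c - r].
  by apply/seteqP; split=> z /=; rewrite /B/= sum_shift subr0.
apply: le_trans; apply: le_measure; rewrite ?inE.
- apply: measurableI; first exact: measurable_phi_sum_level.
  exact: measurable_phi_ge.
- apply: measurableI; last exact: measurable_phi_ge.
  by rewrite -[X in measurable X]setTI; exact: measurable_shift_phi.
- move=> z [zc ze]; split; last exact: le_trans ze.
  by rewrite /= /B/= sum_shift zc.
Qed.

(** The level sets c - e / k are disjoint, and each has at least the measure of
    the part of the level set c where coordinate i0 is at least e. *)
Lemma level_away_null i0 c e : 0 < e ->
  mu [set z | phi_sum z = c /\ e <= phi (tnth z i0)] = 0%E.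
Proof.
move=> e0; set L := [set z | _].
pose r k : R := e / k.+1%:R.
pose S k : set T := [set z | phi_sum z = c - r k].
have mS k : measurable (S k) by exact: measurable_phi_sum_level.
have tS : trivIset setT S.
  apply/trivIsetP => i j _ _ ij; apply/seteqP; split=> // z [/= zi zj].
  have : r i = r j by apply/oppr_inj/(addrI c); rewrite -zi.
  rewrite /r => /(mulfI (lt0r_neq0 e0))/invr_inj/eqP.
  by rewrite eqr_nat eqSS (negbTE ij).
have le k : (mu L <= mu (S k))%E.
  apply: level_shift_le; rewrite divr_ge0 ?(ltW e0)//=.
  by rewrite ler_pdivrMr// ler_peMr ?(ltW e0)// ler1n.
have mL : measurable L.
  apply: measurableI; first exact: measurable_phi_sum_level.
  exact: measurable_phi_ge.
have fL : mu L \is a fin_num by exact: fin_num_measure.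
have bound N : N%:R * fine (mu L) <= 1.
  have -> : N%:R * fine (mu L) = \sum_(k < N) fine (mu L).
    by rewrite sumr_const card_ord mulr_natl.
  rewrite -lee_fin -sumEFin fineK//.
  apply: (@le_trans _ _ (\sum_(k < N) mu (S k))%E); first by apply: lee_sum.
  rewrite -(measure_bigsetU_ord mu predT)//.
    by apply: probability_le1; exact: bigsetU_measurable.
  by move=> i j _ _ ij; apply: val_inj; exact: tS.
apply/eqP; rewrite -(fineK fL) eqe eq_le fine_ge0// andbT leNgt.
apply/negP => x0; have := bound (Num.trunc (fine (mu L))^-1).+1.
rewrite leNgt => /negP; apply; rewrite -ltr_pdivrMr// div1r.
exact: truncnS_gt.
Qed.

Lemma level_null c : 0 < c -> mu.-negligible [set z | phi_sum z = c].
Proof.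
move=> c0.
pose L (ik : 'I_l * nat) : set T :=
  [set z | phi_sum z = c /\ ik.2.+1%:R^-1 <= phi (tnth z ik.1)].
apply: (@negligibleS _ _ _ _ [set z | exists ik, L ik z]).
  move=> z /= zc; have [i zi] : exists i, 0 < phi (tnth z i).
    apply: contrapT => nz; move: c0; rewrite -zc /phi_sum big1 ?ltxx// => i _.
    apply/eqP; rewrite eq_le phi_ge0 andbT leNgt.
    by apply/negP => zi; apply: nz; exists i.
  exists (i, Num.trunc (phi (tnth z i))^-1); split=> //=.
  rewrite -[leRHS]invrK lef_pV2 ?posrE ?invr_gt0//.
  exact/ltW/truncnS_gt.
apply: negligible_exists => -[i k]; apply/negligibleP.
  apply: measurableI; first exact: measurable_phi_sum_level.
  exact: measurable_phi_ge.
by apply: level_away_null; rewrite invr_gt0.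
Qed.

(** A point whose sum exceeds c = phi (0) lies in an orthant with rational
    corner whose sum is still at least c, and such an orthant has measure 0.
    The points with sum c form a level set. *)
Lemma upper_null : mu.-negligible [set z | psi (phi_sum z) = 0].
Proof.
have [[c cE]|ninf] := pselect (exists c : R, pseudoinv psi 0 = c%:E);
    last first.
  rewrite (_ : [set z | _] = set0); first exact: negligible_set0.
  apply/seteqP; split=> // z /= z0.
  have s0 : 0 <= phi_sum z by apply: sumr_ge0 => i _; exact: phi_ge0.
  have := pseudoinv0_le s0 z0; have := pseudoinv_ge0 psi 0.
  by case: pseudoinv ninf => // c' [] ; exists c'.
have c0 : 0 < c.
  by rewrite -lte_fin -cE lt_pseudoinv0// (generator0 G).
have psi0 s : c <= s -> psi s = 0.
  by move=> cs; have := @ext0_gen_eq0 _ _ G s%:E; rewrite cE lee_fin => /(_ cs).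
pose U (mk : nat * {ffun 'I_l -> nat}) : set T :=
  if c <= \sum_i (mk.2 i)%:R / mk.1.+1%:R then
  [set z | forall i, (mk.2 i)%:R / mk.1.+1%:R <= phi (tnth z i)] else set0.
apply: (@negligibleS _ _ _ _
    ([set z | phi_sum z = c] `|` [set z | exists mk, U mk z])); last first.
  apply: negligibleU; first exact: level_null.
  apply: negligible_exists => -[m k]; rewrite /U/=.
  case: ifPn => [ck|_]; last exact: negligible_set0.
  apply/negligibleP.
    by apply: measurable_forall => i; exact: measurable_phi_ge.
  have q0 (i : 'I_l) : 0 <= (k i)%:R / m.+1%:R :> R by rewrite divr_ge0.
  by have := psi_law_orthant G lawmu q0; rewrite psi0.
move=> z /= z0.
have s0 : 0 <= phi_sum z by apply: sumr_ge0 => i _; exact: phi_ge0.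
have cs : c <= phi_sum z by rewrite -lee_fin -cE pseudoinv0_le.
have [->|cs'] := eqVneq (phi_sum z) c; [by left|right].
have {cs'}cs : c < phi_sum z by rewrite lt_neqAle eq_sym cs' cs.
(* a grid of mesh 1 / (m + 1) loses at most l / (m + 1) <= phi_sum z - c *)
pose m := Num.trunc (l%:R / (phi_sum z - c)).
have m0 : 0 < m.+1%:R :> R by [].
have lm : l%:R / m.+1%:R <= phi_sum z - c.
  rewrite ler_pdivrMr// mulrC -ler_pdivrMr ?subr_gt0//.
  exact/ltW/truncnS_gt.
pose k := [ffun i => Num.trunc (phi (tnth z i) * m.+1%:R)].
have kle i : (k i)%:R / m.+1%:R <= phi (tnth z i).
  by rewrite ler_pdivrMr// ffunE truncn_le// mulr_ge0 ?phi_ge0.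
have klt i : phi (tnth z i) - m.+1%:R^-1 <= (k i)%:R / m.+1%:R.
  rewrite ler_pdivlMr// mulrBl mulVf ?gt_eqF// lerBlDr natr1 ffunE.
  exact/ltW/truncnS_gt.
exists (m, k); rewrite /U/= ifT//.
apply: (@le_trans _ _ (\sum_i (phi (tnth z i) - m.+1%:R^-1)));
  last exact: ler_sum.
rewrite sumrB -/(phi_sum z) sumr_const card_ord -[_^-1 *+ l]mulr_natl.
by rewrite lerBrDr -lerBrDl.
Qed.

End NullSets.

(** * Convergence of the generators *)

Section GeneratorConvergence.
Variable R : realType.

(** Add the convexity inequalities at a < a + b < s + b and a < s < s + b: the
    two middle points have the same barycentre as the two end points. *)
Lemma convex_pos_increment (f : R -> R) (a s b : R) : convex_pos f ->
  0 < a -> a <= s -> 0 < b -> f (a + b) - f (s + b) <= f a - f s.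
Proof.
move=> cf a0; rewrite le_eqVlt => /orP[/eqP->|as_] b0; first by rewrite !subrr.
have := cf a (a + b) (s + b) a0 ltac:(lra) ltac:(lra).
have := cf a s (s + b) a0 as_ ltac:(lra).
rewrite (_ : s + b - s = b); last by ring.
rewrite (_ : a + b - a = b); last by ring.
rewrite (_ : s + b - (a + b) = s - a); last by ring.
move: (f (a + b)) (f (s + b)) (f a) (f s) => u v w z h1 h2.
rewrite -(@ler_pM2r _ (s - a + b)); last lra.
nra.
Qed.

(** On the scale of the generator, this is the Lipschitz property of the
    bivariate copula: |C (u, v) - C (u', v')| <= |u - u'| + |v - v'|. *)
Lemma convex_decr_dist (f : R -> R) (a b s t : R) : convex_decr f ->
  0 < a -> 0 < b -> 0 < s -> 0 < t ->
  `|f (a + b) - f (s + t)| <= `|f a - f s| + `|f b - f t|.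
Proof.
move=> [_ fd fc].
have one x y z : 0 < x -> 0 < y -> 0 < z ->
    `|f (x + z) - f (y + z)| <= `|f x - f y|.
  move=> x0 y0 z0; wlog xy : x y x0 y0 / x <= y => [wl|].
    have [/wl->//|/ltW/wl h] := leP x y.
    by rewrite distrC [leRHS]distrC h.
  rewrite !ger0_norm ?subr_ge0; first exact: convex_pos_increment.
    exact: fd.
  by apply: fd; lra.
move=> a0 b0 s0 t0.
rewrite (_ : f (a + b) - f (s + t) =
  (f (a + b) - f (s + b)) + (f (b + s) - f (t + s))); last first.
  by rewrite ![_ + s]addrC; ring.
by apply: le_trans (ler_normD _ _) _; apply: lerD; exact: one.
Qed.

Variables (psi : R -> R) (psin : nat -> R -> R).
Hypotheses (G : is_generator psi) (Gn : forall n, is_generator (psin n)).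

(** C_n (psi a, psi b, 1, ..., 1) converges to C (psi a, psi b, 1, ..., 1); both
    are evaluated through their generators. *)
Lemma copula_cvg_psi d (C : d.-tuple R -> R) (Cn : nat -> d.-tuple R -> R) a b :
  (2 <= d)%N -> archimedean_copula psi C ->
  (forall n, archimedean_copula (psin n) (Cn n)) ->
  (forall x, cube x -> Cn n x @[n --> \oo] --> C x) ->
  0 <= a -> 0 <= b -> 0 < psi a -> 0 < psi b ->
  psin n (phi (psin n) (psi a) + phi (psin n) (psi b)) @[n --> \oo]
    --> psi (a + b).
Proof.
move=> d2 aC aCn CnC a0 b0 pa pb.
pose c (j : nat) := match j with 0 => a | 1 => b | _ => 0 end.
have c0 j : 0 <= c j by case: j => [|[|j]].
have pc j : 0 < psi (c j) by case: j => [|[|j]]//=; rewrite (generator0 G).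
have sumc (F : nat -> R) : (forall j, (2 <= j)%N -> F j = 0) ->
    \sum_(j < d) F j = F 0%N + F 1%N.
  by move=> F0; rewrite (sum_ord_widen0 d2)// !big_ord_recl big_ord0 addr0.
have := CnC [tuple psi (c i) | i < d] (cube_psi G (fun i => c0 i)).
rewrite (archimedean_psi G aC)// (sumc c); last by move=> [|[|]].
apply: cvg_trans; apply: near_eq_cvg; near=> n.
have -> : [tuple psi (c i) | i < d] =
    [tuple psin n (phi (psin n) (psi (c i))) | i < d].
  by apply: eq_from_tnth => i; rewrite !tnth_mktuple phi_psi// gen_itv.
rewrite (archimedean_psi (Gn n) (aCn n)); last by move=> i; exact: phi_ge0.
rewrite (sumc (fun j => phi (psin n) (psi (c j))))// => -[|[|j]]//= _.
rewrite (generator0 G) -[in LHS](generator0 (Gn n)) phiK//.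
by rewrite (generator0 (Gn n)).
Unshelve. all: by end_near. Qed.

Hypothesis add_cvg : forall a b, 0 <= a -> 0 <= b -> 0 < psi a -> 0 < psi b ->
  psin n (phi (psin n) (psi a) + phi (psin n) (psi b)) @[n --> \oo]
    --> psi (a + b).
Hypothesis dn : forall n, convex_decr (psin n).

Lemma phi_psi_gt0 n a : 0 < a -> 0 < psi a -> 0 < phi (psin n) (psi a).
Proof.
move=> a0 pa; rewrite lt_neqAle phi_ge0 andbT; apply/eqP => E.
have := phi_psi (Gn n) (gen_itv G (ltW a0) pa).
rewrite -E (generator0 (Gn n)) => p1.
by have := gen_lt G (lexx 0) a0; rewrite (generator0 G) -p1 ltxx => /(_ ltr01).
Qed.

(** For a < t the limit of psi_n (2 phi_n (psi a)) is psi (2 a) > psi (2 t), so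
    eventually phi_n (psi a) <= t, that is psi_n t <= psi a.  Points b > t give
    the lower bound. *)
Lemma gen_half_cvg t : 0 < t -> 0 < psi (t + t) ->
  psin n (t + t) @[n --> \oo] --> psi (t + t) ->
  psin n t @[n --> \oo] --> psi t.
Proof.
move=> t0 ptt ctt; apply/cvgrPdist_lt => e e0.
have pt : 0 < psi t.
  by apply: lt_le_trans ptt _; apply: (generator_nonincreasing G); lra.
have ct := gen_continuous G t0.
have [a [a0 ta pae]] : exists a, [/\ 0 < a, a < t & psi a < psi t + e].
  near t^'- => a; exists a; split.
  - by near: a; exact: nbhs_left_gt.
  - by near: a; exact: nbhs_left_lt.
  - near: a; apply: (@cvgr_lt _ _ _ _ psi (psi t)); last lra.
    exact: cvg_at_left_filter ct.
have [b [tb pb pbe]] : exists b, [/\ t < b, 0 < psi b & psi t - e < psi b].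
  near t^'+ => b; exists b; split.
  - by near: b; exact: nbhs_right_gt.
  - near: b; apply: (@cvgr_gt _ _ _ _ psi (psi t)); last lra.
    exact: cvg_at_right_filter ct.
  - near: b; apply: (@cvgr_gt _ _ _ _ psi (psi t)); last lra.
    exact: cvg_at_right_filter ct.
have pa : 0 < psi a.
  by apply: lt_le_trans pt _; apply: (generator_nonincreasing G); lra.
have ca := add_cvg (ltW a0) (ltW a0) pa pa.
have b0 : 0 <= b by lra.
have cb := add_cvg b0 b0 pb pb.
have tta : psi (t + t) < psi (a + a).
  apply: (gen_lt G); [lra|lra|].
  by apply: lt_le_trans ptt _; apply: (generator_nonincreasing G); lra.
have ttb : psi (b + b) < psi (t + t) by apply: (gen_lt G); lra.
pose m1 := (psi (t + t) + psi (a + a)) / 2.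
pose m2 := (psi (t + t) + psi (b + b)) / 2.
near=> n.
have A1 : m1 < psin n (phi (psin n) (psi a) + phi (psin n) (psi a)).
  by near: n; apply: (cvgr_gt _ ca); rewrite /m1; lra.
have A2 : psin n (t + t) < m1.
  by near: n; apply: (cvgr_lt _ ctt); rewrite /m1; lra.
have B1 : psin n (phi (psin n) (psi b) + phi (psin n) (psi b)) < m2.
  by near: n; apply: (cvgr_lt _ cb); rewrite /m2; lra.
have B2 : m2 < psin n (t + t).
  by near: n; apply: (cvgr_gt _ ctt); rewrite /m2; lra.
have la : phi (psin n) (psi a) <= t.
  rewrite leNgt; apply/negP => h.
  have tt0 := ltW (addr_gt0 t0 t0).
  have := generator_nonincreasing (Gn n) tt0 (ltW (ltrD h h)).
  by rewrite leNgt (lt_trans A2 A1).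
have lb : t <= phi (psin n) (psi b).
  rewrite leNgt; apply/negP => h.
  have p0 := phi_ge0 (psin n) (psi b).
  have := generator_nonincreasing (Gn n) (addr_ge0 p0 p0) (ltW (ltrD h h)).
  by rewrite leNgt (lt_trans B1 B2).
have := generator_nonincreasing (Gn n) (phi_ge0 _ _) la.
have := generator_nonincreasing (Gn n) (ltW t0) lb.
rewrite !phi_psi ?(gen_itv G)// ?(ltW a0)// => h1 h2.
rewrite ltr_distlC (lt_le_trans pbe h1).
exact: le_lt_trans h2 pae.
Unshelve. all: by end_near. Qed.

(** If psi s and psi t are positive, psi_n (phi_n (psi s) + phi_n (psi t)) has
    the right limit, and differs from psi_n (s + t) by at most
    |psi s - psi_n s| + |psi t - psi_n t|.  Otherwise psi_n (s + t) is squeezed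
    to 0. *)
Lemma gen_add_cvg s t : 0 < s -> 0 < t ->
  psin n s @[n --> \oo] --> psi s -> psin n t @[n --> \oo] --> psi t ->
  psin n (s + t) @[n --> \oo] --> psi (s + t).
Proof.
have zero x y : 0 < x -> 0 < y -> psi x = 0 ->
    psin n x @[n --> \oo] --> psi x ->
    psin n (x + y) @[n --> \oo] --> psi (x + y).
  move=> x0 y0 px cx.
  have -> : psi (x + y) = 0.
    apply/eqP; rewrite eq_le (gen_ge0 G) ?andbT; last lra.
    by rewrite -px; apply: (generator_nonincreasing G); lra.
  rewrite px in cx; apply: (squeeze_cvgr _ (cvg_cst 0) cx).
  near=> n; rewrite (gen_ge0 (Gn n))/=; last lra.
  by apply: (generator_nonincreasing (Gn n)); lra.
move=> s0 t0 cs ct.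
have [ps|] := ltP 0 (psi s); last first.
  move=> ps; apply: zero => //; apply/eqP.
  by rewrite eq_le ps (gen_ge0 G)// ltW.
have [pt|] := ltP 0 (psi t); last first.
  move=> pt; rewrite addrC.
  by apply: zero => //; apply/eqP; rewrite eq_le pt (gen_ge0 G)// ltW.
have cst := add_cvg (ltW s0) (ltW t0) ps pt.
apply/cvgrPdist_lt => e e0.
have e3 : 0 < e / 3 by lra.
have /cvgrPdist_lt/(_ _ e3) ns := cs.
have /cvgrPdist_lt/(_ _ e3) nt := ct.
have /cvgrPdist_lt/(_ _ e3) nst := cst.
near=> n.
have d1 : `|psi s - psin n s| < e / 3.
  by near: n.
have d2 : `|psi t - psin n t| < e / 3.
  by near: n.
have : `|psi (s + t) - psin n (phi (psin n) (psi s) + phi (psin n) (psi t))|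
    < e / 3 by near: n.
set a := phi (psin n) (psi s); set b := phi (psin n) (psi t) => d3.
have d4 := convex_decr_dist (dn n)
  (phi_psi_gt0 n s0 ps) (phi_psi_gt0 n t0 pt) s0 t0.
rewrite !phi_psi ?(gen_itv G) ?(ltW s0) ?(ltW t0)// -/a -/b in d4.
have := ler_normD (psi (s + t) - psin n (a + b))
  (psin n (a + b) - psin n (s + t)).
rewrite addrA subrK => /le_lt_trans; apply; lra.
Unshelve. all: by end_near. Qed.

(** The normalisation psi_n (1) = 1/2 is the start of the induction. *)
Lemma gen_pow_cvg k : psin n (2^-1 ^+ k) @[n --> \oo] --> psi (2^-1 ^+ k).
Proof.
elim: k => [|k IH].
  rewrite expr0 (generator_normalized G).
  by under eq_fun do rewrite (generator_normalized (Gn _)); exact: cvg_cst.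
have E : 2^-1 ^+ k.+1 + 2^-1 ^+ k.+1 = 2^-1 ^+ k :> R by rewrite exprS; field.
apply: gen_half_cvg; rewrite ?E//.
apply: (@lt_le_trans _ _ (psi 1)); first by rewrite (generator_normalized G).
apply: (generator_nonincreasing G); first by rewrite exprn_ge0.
by rewrite exprn_ile1//; lra.
Qed.

Lemma gen_dyadic_cvg m k : (0 < m)%N ->
  psin n (m%:R * 2^-1 ^+ k) @[n --> \oo] --> psi (m%:R * 2^-1 ^+ k).
Proof.
case: m => // m _; elim: m => [|m IH].
  by rewrite mul1r; exact: gen_pow_cvg.
have -> : m.+2%:R * 2^-1 ^+ k = m.+1%:R * 2^-1 ^+ k + 2^-1 ^+ k :> R.
  by rewrite -[m.+2]addn1 natrD mulrDl mul1r.
by apply: gen_add_cvg => //; exact: gen_pow_cvg.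
Qed.

Lemma gen_cvg x : 0 < x -> psin n x @[n --> \oo] --> psi x.
Proof.
move=> x0; apply/cvgrPdist_lt => e e0.
have /cvgrPdist_lt/(_ _ e0)[/= r r0 near_x] := gen_continuous G x0.
pose r' := Num.min r x.
have r'0 : 0 < r' by rewrite lt_min r0.
have r'r : r' <= r by rewrite ge_min lexx.
have r'x : r' <= x by rewrite ge_min lexx orbT.
have [k [k0 kr]] : exists k, 0 < 2^-1 ^+ k :> R /\ 2^-1 ^+ k < r'.
  near \oo => k; exists k; split; first by rewrite exprn_gt0.
  near: k; apply: (cvgr_lt (0 : R)) => //.
  by apply: cvg_expr; rewrite ger0_norm; lra.
pose h : R := 2^-1 ^+ k; rewrite -/h in k0 kr.
pose m := Num.trunc (x / h).
have mx : m%:R * h <= x.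
  by rewrite -ler_pdivlMr// truncn_le// divr_ge0// ltW.
have xm : x < m.+1%:R * h by rewrite -ltr_pdivrMr// truncnS_gt.
have mS : m.+1%:R * h = m%:R * h + h by rewrite -natr1 mulrDl mul1r.
have m0 : (0 < m)%N.
  by rewrite lt0n; apply/eqP => E; rewrite mS E mul0r add0r in xm; lra.
have y0 : 0 < m%:R * h by rewrite mulr_gt0// ltr0n.
have cy := @gen_dyadic_cvg m k m0; have cz := @gen_dyadic_cvg m.+1 k (ltn0Sn m).
rewrite -/h in cy cz.
have ny := near_x (m%:R * h) ltac:(by rewrite /= ger0_norm; lra).
have nz := near_x (m.+1%:R * h) ltac:(by rewrite /= ler0_norm; lra).
move: ny nz; rewrite !ltr_distl => /andP[ny _] /andP[_ nz].
near=> n.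
have n1 : psin n (m%:R * h) < psi x + e.
  by near: n; apply: (cvgr_lt _ cy); lra.
have n2 : psi x - e < psin n (m.+1%:R * h).
  by near: n; apply: (cvgr_gt _ cz); lra.
have := generator_nonincreasing (Gn n) (ltW y0) mx.
have := generator_nonincreasing (Gn n) (ltW x0) (ltW xm).
by rewrite ltr_distlC => h1 h2; apply/andP; split; lra.
Unshelve. all: by end_near. Qed.

Lemma phi_cvg u : 0 < u < 1 -> phi (psin n) u @[n --> \oo] --> phi psi u.
Proof.
move=> /andP[u0 u1]; have u01 : 0 < u <= 1 by rewrite u0 ltW.
have a0 : 0 < phi psi u.
  rewrite lt_neqAle phi_ge0 andbT; apply/eqP => E.
  by have := phi_psi G u01; rewrite -E (generator0 G); lra.
set a := phi psi u in a0 *.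
have pa : psi a = u by exact: phi_psi.
apply/cvgrPdist_le => e e0.
pose e' := Num.min e (a / 2).
have e'0 : 0 < e' by rewrite lt_min e0; lra.
have e'e : e' <= e by rewrite ge_min lexx.
have e'a : e' <= a / 2 by rewrite ge_min lexx orbT.
have h1 : u < psi (a - e').
  rewrite -pa; apply: (gen_lt G); [lra|lra|].
  apply: lt_le_trans u0 _; rewrite -pa.
  by apply: (generator_nonincreasing G); lra.
have h2 : psi (a + e') < u.
  by rewrite -[ltRHS]pa; apply: (gen_lt G); [lra|lra|rewrite pa].
have am : 0 < a - e' by lra.
have ap : 0 < a + e' by lra.
near=> n.
have n1 : u < psin n (a - e') by near: n; apply: (cvgr_gt _ (gen_cvg am)).
have n2 : psin n (a + e') < u by near: n; apply: (cvgr_lt _ (gen_cvg ap)).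
have l1 : a - e' <= phi (psin n) u by rewrite (le_phi (Gn n)) ?(ltW am)// ltW.
have l2 : phi (psin n) u <= a + e'.
  by apply: ltW; rewrite ltNge (le_phi (Gn n)) ?(ltW ap)// -ltNge.
by rewrite ler_distlC; apply/andP; split; lra.
Unshelve. all: by end_near. Qed.

End GeneratorConvergence.

(** * Derivatives of the generators and the Markov kernel *)

Section GeneratorDerivative.
Variable R : realType.
Variables (m l : nat).
Hypothesis hl : (1 <= l <= m.+1)%N.
Local Notation gd := (generator_derive m.+2 l).

Lemma generator_derive_low (f : R -> R) : (l <= m)%N ->
  gd f = fun x => (-1) ^+ l * alt_derive f l x.
Proof.
by move=> lm; rewrite /generator_derive /= ltn_eqF ?ltnS// -derive1n_alt.
Qed.

Lemma generator_derive_top (f : R -> R) x :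
  l = m.+1 -> diff_monotone m f -> 0 < x ->
  gd f x = (-1) ^+ m * left_derive (alt_derive f m) x.
Proof.
move=> lm fc x0; rewrite /generator_derive /= lm eqxx derive1n_alt.
apply: left_derive_scale => //.
have [+ _] := alt_derive_monotone (leqnn m) fc.
by move=> /diff_monotone_convex_decr[].
Qed.

Lemma l_cases : (l <= m)%N \/ l = m.+1.
Proof.
by case/andP: hl => _; rewrite leq_eqVlt => /orP[/eqP|]; [right|left].
Qed.

Lemma generator_derive_neq0 (f : R -> R) s :
  diff_monotone m f -> 0 < s -> 0 < f s ->
  f z @[z --> +oo] --> 0 -> gd f s != 0.
Proof.
move=> fc s0 fs f0; case: l_cases => lm.
  rewrite generator_derive_low// mulf_neq0 ?signr_eq0// gt_eqF//.
  by have [] := alt_derive_pos lm fc s0 fs f0.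
rewrite generator_derive_top// mulf_neq0 ?signr_eq0//.
have [_ n0] := alt_derive_pos (leqnn m) fc s0 fs f0.
have [/diff_monotone_convex_decr[_ _ gc] _] := alt_derive_monotone (leqnn m) fc.
have [_ sg] := left_derive_lim s0 gc.
by apply/eqP => E; apply: n0; rewrite -E.
Qed.

Lemma derive1n_zero (f : R -> R) c j : (forall x, c < x -> f x = 0) ->
  forall x, c < x -> derive1n j f x = 0.
Proof.
move=> f0; elim: j => [//|j IH] x cx.
rewrite derive1nS derive1E (@near_eq_derive _ _ _ _ (cst 0)) ?derive_cst//.
by near=> y; apply: IH; near: y; apply: (cvgr_gt x).
Unshelve. all: by end_near. Qed.

Lemma left_derive_zero (f : R -> R) c : (forall x, c < x -> f x = 0) ->
  forall x, c < x -> left_derive f x = 0.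
Proof.
move=> f0 x cx; apply: cvg_lim => //.
apply: (@cvg_trans _ ((cst 0 : R -> R) @ 0^'-)); last exact: cvg_cst.
apply: near_eq_cvg; near=> h.
rewrite !f0 ?subrr ?mul0r// -ltrBlDl.
by near: h; apply: nbhs_left_gt; rewrite subr_lt0.
Unshelve. all: by end_near. Qed.

Lemma generator_derive_zero (f : R -> R) x : is_generator f ->
  (pseudoinv f 0 < x%:E)%E -> gd f x = 0.
Proof.
move=> G; have := pseudoinv_ge0 f 0; case E : pseudoinv => [c| |]// c0.
rewrite lte_fin => cx.
have f0 y : c < y -> f y = 0.
  move=> cy; have := @ext0_gen_eq0 _ _ G y%:E.
  by rewrite E lee_fin => /(_ (ltW cy)).
rewrite /generator_derive; case: ifP => _; last exact: derive1n_zero f0 _ cx.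
apply: left_derive_zero cx; exact: derive1n_zero.
Qed.

(** For l <= m the derivatives are, up to sign, convex and nonincreasing, and N
    is empty; for l = m + 1 the left derivatives are, up to sign, subgradients
    of the derivative of order m, and N collects its kinks. *)
Lemma generator_derive_cvg (psi : R -> R) (psin : nat -> R -> R) :
  diff_monotone m psi -> (forall n, diff_monotone m (psin n)) ->
  (forall x, 0 < x -> psin n x @[n --> \oo] --> psi x) ->
  exists2 N : set R, countable N &
    forall (X : nat -> R) (x : R), 0 < x -> ~ N x -> X n @[n --> \oo] --> x ->
      gd (psin n) (X n) @[n --> \oo] --> gd psi x.
Proof.
move=> pc pnc pn.
have low j (X : nat -> R) (x : R) : (j <= m)%N -> 0 < x ->
    X n @[n --> \oo] --> x ->
    alt_derive (psin n) j (X n) @[n --> \oo] --> alt_derive psi j x.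
  move=> jm x0 Xx.
  apply: (convex_decr_cvg (F := fun n => alt_derive (psin n) j)) => //.
  - move=> n.
    by have [/diff_monotone_convex_decr] := alt_derive_monotone jm (pnc n).
  - by have [/diff_monotone_convex_decr] := alt_derive_monotone jm pc.
  - exact: alt_derive_cvg jm pnc pc pn.
case: l_cases => lm.
  exists set0 => // X x x0 _ Xx; rewrite generator_derive_low//.
  under eq_fun do rewrite generator_derive_low//.
  by apply: cvgM; [exact: cvg_cst|exact: low].
exists [set x | 0 < x /\ ~ smooth_at (alt_derive psi m) x].
  exact: countable_kinks.
move=> X x x0 Nx Xx; rewrite generator_derive_top//.
have dg n : convex_pos (alt_derive (psin n) m).
  have [+ _] := alt_derive_monotone (leqnn m) (pnc n).
  by move=> /diff_monotone_convex_decr[].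
have gc : convex_pos (alt_derive psi m).
  by have [/diff_monotone_convex_decr[]] := alt_derive_monotone (leqnn m) pc.
suff : (-1) ^+ m * left_derive (alt_derive (psin n) m) (X n) @[n --> \oo] -->
    (-1) ^+ m * left_derive (alt_derive psi m) x.
  apply: cvg_trans; apply: near_eq_cvg; near=> n.
  by rewrite generator_derive_top//; near: n; apply: (cvgr_gt x).
apply: cvgM; first exact: cvg_cst.
apply: (@subgradient_cvg _ (fun n => alt_derive (psin n) m)
  (alt_derive psi m) X x) => //.
- exact: alt_derive_cvg (leqnn m) pnc pc pn.
- exact: low.
- by move=> n Xn; have [] := left_derive_lim Xn (dg n).
- by apply: contrapT => ns; apply: Nx.
- by have [] := left_derive_lim x0 gc.
Unshelve. all: by end_near. Qed.

End GeneratorDerivative.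

Section Kernel.
Variables (R : realType) (d l : nat).

Definition phi_sum_rV (psi : R -> R) n (y : 'rV[R]_n) : R :=
  \sum_j phi psi (y ord0 j).

(** The case s + t > phi (0), where the kernel is 0, is covered because the
    numerator vanishes there. *)
Lemma markov_kernelE (psi : R -> R) (x : l.-tuple R) (y : 'rV[R]_(d - l)) :
  is_generator psi -> @pos_cube R l x -> (exists i, tnth x i < 1) ->
  0 < psi (phi_sum psi x) -> (forall j, 0 < y ord0 j <= 1) ->
  (forall r, (pseudoinv psi 0 < r%:E)%E -> generator_derive d l psi r = 0) ->
  markov_kernel psi x y =
    generator_derive d l psi (phi_sum psi x + phi_sum_rV psi y) /
    generator_derive d l psi (phi_sum psi x).
Proof.
move=> G px [i xi] ps py gz; rewrite /markov_kernel.
have -> : (\sum_(i < l) pseudoinv psi (tnth x i))%E = (phi_sum psi x)%:E.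
  rewrite /phi_sum -sumEFin; apply: eq_bigr => j _.
  by rewrite pseudoinvE.
have -> : (\sum_(j < d - l) pseudoinv psi (y ord0 j))%E = (phi_sum_rV psi y)%:E.
  rewrite /phi_sum_rV -sumEFin; apply: eq_bigr => j _.
  by rewrite pseudoinvE.
have s0 : 0 <= phi_sum psi x by apply: sumr_ge0 => j _; exact: phi_ge0.
rewrite leNgt -(gen_gt0 G)// ps orbF lt_eqF; last first.
  by apply: le_lt_trans xi; exact: bigmin_le_cond.
rewrite -EFinD /=; case: ifP => // /gz ->.
by rewrite mul0r.
Qed.

End Kernel.

Section Assembly.
Variables (R : realType) (d : nat).

(** Pull the given point slightly towards the centre of the cube.  Since phi is
    injective, only countably many values of the first coordinate are then
    forbidden. *)
Lemma closure_cube_rV n (psi : R -> R) (N : set R) (s : R) : (0 < n)%N ->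
  is_generator psi -> countable N ->
  @cube_rV R n `<=`
  closure [set y : 'rV[R]_n |
    (forall j, 0 < y ord0 j < 1) /\ ~ N (s + phi_sum_rV psi y)].
Proof.
move=> n0 G cN p pc B /nbhs_ballP[e /= e0 eB].
pose j0 := Ordinal n0.
pose t := Num.min (e / 2) 2^-1.
have t0 : 0 < t by rewrite lt_min invr_gt0 ltr0n andbT; lra.
have te : t <= e / 2 by rewrite ge_min lexx.
have t1 : t <= 2^-1 by rewrite ge_min lexx orbT.
(* q j keeps a distance of at least t / 2 from both ends of [0, 1] *)
pose q j := p ord0 j + t * (2^-1 - p ord0 j).
have q01 j : t / 2 <= q j <= 1 - t / 2.
  have /andP[] := pc j; rewrite /q; move: (p ord0 j) => a a0 a1.
  by apply/andP; split; nra.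
have qe j : `|p ord0 j - q j| <= t / 2.
  have /andP[] := pc j; rewrite /q; move: (p ord0 j) => a a0 a1.
  by rewrite ler_norml; apply/andP; split; nra.
pose r := \sum_(j | j != j0) phi psi (q j).
pose K := [set u | 0 < u <= 1 /\ N (s + (phi psi u + r))].
have cK : countable K.
  move/countable_injP : cN => [f injf]; apply/countable_injP.
  exists (fun u => f (s + (phi psi u + r))) => u v.
  rewrite !inE => -[u01 Nu] [v01 Nv] /injf; rewrite !inE => /(_ Nu Nv).
  by move=> /addrI/addIr E; rewrite -(phi_psi G u01) E (phi_psi G v01).
have lt_q0 : q j0 - t / 2 < q j0 + t / 2 by lra.
have [u /andP[lu ul] nKu] := itv_minus_countable cK lt_q0.
have u01 : 0 < u < 1 by have := q01 j0; lra.
pose y : 'rV[R]_n := \row_j (if j == j0 then u else q j).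
exists y; split.
  split=> [j|]; first by rewrite mxE; case: ifP => // _; have := q01 j; lra.
  rewrite /phi_sum_rV (bigD1 j0)//= mxE eqxx.
  rewrite (eq_bigr (fun j => phi psi (q j))) => [Ny|j /negbTE jj];
    last by rewrite mxE jj.
  by apply: nKu; split=> //; case/andP: u01 => -> /ltW.
apply: eB; split=> // i j; rewrite ord1 /ball/= mxE.
case: eqP => [->|_]; have := qe j0; have := qe j;
  rewrite !ler_norml ltr_norml; lra.
Qed.

Lemma phi_cvg1 (psi : R -> R) (psin : nat -> R -> R) u :
  is_generator psi -> (forall n, is_generator (psin n)) ->
  (forall v, 0 < v < 1 -> phi (psin n) v @[n --> \oo] --> phi psi v) ->
  0 < u <= 1 -> phi (psin n) u @[n --> \oo] --> phi psi u.
Proof.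
move=> G Gn pc /andP[u0]; rewrite le_eqVlt => /orP[/eqP->|u1]; last first.
  by apply: pc; rewrite u0.
have one f : is_generator f -> phi f 1 = 0.
  by move=> Gf; rewrite -[in LHS](generator0 Gf) phiK// (generator0 Gf).
by rewrite one//; under eq_fun do rewrite one//; exact: cvg_cst.
Qed.

Lemma phi_sum_cvg n (a : 'I_n -> R) (psi : R -> R) (psin : nat -> R -> R) :
  (forall i, phi (psin k) (a i) @[k --> \oo] --> phi psi (a i)) ->
  \sum_i phi (psin k) (a i) @[k --> \oo] --> \sum_i phi psi (a i).
Proof.
move=> pc; elim: (index_enum _) => [|i r IH].
  by rewrite big_nil; under eq_fun do rewrite big_nil; exact: cvg_cst.
by rewrite big_cons; under eq_fun do rewrite big_cons; exact: cvgD.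
Qed.

Section ExceptionalSet.
Variables (l : nat) (psi : R -> R) (G : is_generator psi) (l0 : (0 < l)%N).
Hypothesis ld : (l < d)%N.
Variables (P : probability (d.-tuple (measurableTypeR R)) R)
  (mu : probability (l.-tuple (measurableTypeR R)) R).
Hypotheses (lawP : psi_law psi P) (lawmu : psi_law psi mu).
Local Notation T := (l.-tuple (measurableTypeR R)).

(** P (A_1 >= q) = psi q tends to 1 as q tends to 0, so A_1 = 0 has probability
    0. *)
Lemma phi_sum0_null : mu.-negligible [set z : T | phi_sum psi z = 0].
Proof.
have mZ : measurable [set z : T | phi_sum psi z = 0].
  exact: measurable_phi_sum_level.
apply/negligibleP => //.
suff : mu [set z : T | phi_sum psi z = 0] = 0%E by [].
apply/eqP; rewrite eq_le measure_ge0 andbT; apply/lee_addgt0Pr => e e0.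
have c0 : psi x @[x --> 0^'+] --> psi 0.
  by have /continuous_within_itvcyP[] := generator_continuous G.
have [q [q0 qe]] : exists q, 0 < q /\ 1 - e < psi q.
  near (0 : R)^'+ => q; exists q; split; first by near: q; exact: nbhs_right_gt.
  near: q; apply: (cvgr_gt _ c0); rewrite (generator0 G); lra.
pose i0 := Ordinal l0.
pose qq (i : 'I_l) := if i == i0 then q else 0.
have qq0 i : 0 <= qq i by rewrite /qq; case: ifP => // _; exact: ltW.
have sq : \sum_i qq i = q.
  by rewrite (bigD1 i0)//= {1}/qq eqxx big1 ?addr0// /qq => j /negbTE ->.
pose A : set T := [set z | forall i, qq i <= phi psi (tnth z i)].
have mA : measurable A by exact: measurable_orthant.
have EA : mu A = (psi q)%:E by rewrite (psi_law_orthant G lawmu qq0) sq.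
apply: (@le_trans _ _ (mu (~` A))).
  apply: le_measure; rewrite ?inE//; first exact: measurableC.
  move=> z /= z0 /(_ i0); rewrite /qq eqxx leNgt => /negP; apply.
  apply: le_lt_trans q0; rewrite -z0 /phi_sum (bigD1 i0)//= lerDl.
  by apply: sumr_ge0 => i _; exact: phi_ge0.
rewrite (probability_setC mu mA) EA add0e -EFinB lee_fin; lra.
Unshelve. all: by end_near. Qed.

Lemma phi_sum_countable_null (N : set R) : countable N ->
  mu.-negligible [set z : T | 0 < phi_sum psi z /\ N (phi_sum psi z)].
Proof.
move=> /countable_injP[f injf].
pose F k : set T := [set z | [/\ 0 < phi_sum psi z, N (phi_sum psi z) &
  f (phi_sum psi z) = k]].
apply: (@negligibleS _ _ _ _ [set z | exists k, F k z]).
  by move=> z [z0 Nz]; exists (f (phi_sum psi z)).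
apply: negligible_exists => k.
have [[c [c0 Nc fc]]|nc] := pselect (exists c, [/\ 0 < c, N c & f c = k]).
  apply: negligibleS (level_null G ld lawP lawmu c0) => z [_ Nz fz].
  by apply: injf; rewrite ?inE// fc.
apply: (@negligibleS _ _ _ _ set0); last exact: negligible_set0.
by move=> z [z0 Nz fz]; apply: nc; exists (phi_sum psi z).
Qed.

Lemma exceptional_null (N : set R) : countable N ->
  exists L : set T, [/\ measurable L, L `<=` @cube R l, mu L = 1%E &
    forall x, L x -> [/\ @pos_cube R l x, 0 < phi_sum psi x,
      0 < psi (phi_sum psi x) & ~ N (phi_sum psi x)]].
Proof.
move=> cN.
have [A [mA A0 subA]] : mu.-negligible (~` [set x | [/\ @pos_cube R l x,
    0 < phi_sum psi x, 0 < psi (phi_sum psi x) & ~ N (phi_sum psi x)]]).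
  have n1 : mu.-negligible (~` @pos_cube R l).
    apply/negligibleP; last exact: (psi_law_pos_cube G lawmu).
    by apply: measurableC; exact: measurable_pos_cube.
  apply: negligibleS (negligibleU (negligibleU n1 phi_sum0_null)
    (negligibleU (upper_null G ld lawP lawmu) (phi_sum_countable_null cN))).
  move=> x nx; have [px|] := pselect (pos_cube x); last by left; left.
  have s0 : 0 <= phi_sum psi x by apply: sumr_ge0 => i _; exact: phi_ge0.
  have [sz|sn0] := eqVneq (phi_sum psi x) 0; first by left; right.
  have sp : 0 < phi_sum psi x by rewrite lt_neqAle eq_sym sn0.
  right; have [p0|pn0] := eqVneq (psi (phi_sum psi x)) 0; first by left.
  right; split=> //; apply: contrapT => nN; apply: nx; split=> //.
  by rewrite lt_neqAle eq_sym pn0 (gen_ge0 G).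
have good x : (~` A) x -> [/\ @pos_cube R l x, 0 < phi_sum psi x,
    0 < psi (phi_sum psi x) & ~ N (phi_sum psi x)].
  by move=> nAx; apply: contrapT => nx; apply: nAx; exact: subA.
exists (~` A); split=> //; first exact: measurableC.
  by move=> x /good[px _ _ _] i; have /andP[/ltW -> ->] := px i.
by rewrite (probability_setC mu mA) A0 sube0.
Qed.

End ExceptionalSet.
End Assembly.

Theorem corollary4p4 (R : realType) (d : nat) (hd : (2 <= d)%N)
    (C : d.-tuple R -> R) (Cn : nat -> d.-tuple R -> R)
    (psi : R -> R) (psin : nat -> R -> R)
    (hC : archimedean_copula psi C)
    (hCn : forall n, archimedean_copula (psin n) (Cn n))
    (hcvg : {uniform @cube R d, Cn @ \oo --> C})
    (l : nat) (hl : (1 <= l <= d.-1)%N)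
    (mu : probability (l.-tuple (measurableTypeR R)) R)
    (hmu : induces (margin C) mu) :
  exists Lambda : set (l.-tuple (measurableTypeR R)),
    [/\ measurable Lambda, Lambda `<=` @cube R l, mu Lambda = 1%E &
      forall x, Lambda x ->
        exists U : set 'rV[R]_(d - l),
          [/\ U `<=` @cube_rV R (d - l),
              @cube_rV R (d - l) `<=` closure U &
              forall y, U y ->
                @markov_kernel R d l (psin n) x y @[n --> \oo]
                  --> @markov_kernel R d l psi x y]].
Proof.
have [[G _ _] Gn] : archimedean_copula psi C /\ forall n, is_generator (psin n).
  by split=> // n; have [] := hCn n.
have [P lawP] := psi_law_copula G hC.
have /andP[l0 ld1] := hl.
have ld : (l < d)%N by rewrite (leq_ltn_trans ld1)// prednK// ltnW.
have lawmu := psi_law_margin G (ltnW ld) hC hmu.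
case: d => [//|[//|m]] in hd C Cn hC hCn hcvg hl hmu P lawP ld1 ld lawmu *.
have pc : diff_monotone m psi by exact: (psi_law_diff_monotone G lawP).
have pnc n : diff_monotone m (psin n).
  have [Q lawQ] := psi_law_copula (Gn n) (hCn n).
  exact: (psi_law_diff_monotone (Gn n) lawQ).
have dn n : convex_decr (psin n) := diff_monotone_convex_decr (pnc n).
have Cx x : cube x -> Cn n x @[n --> \oo] --> C x.
  move=> cx; have sub : [set x] `<=` @cube R m.+2 by move=> _ ->.
  have := uniform_subset_cvg _ sub hcvg; rewrite uniform_set1; apply.
have add_cvg a b := copula_cvg_psi G Gn hd hC hCn Cx (a := a) (b := b).
have pn x : 0 < x -> psin n x @[n --> \oo] --> psi x.
  exact: (gen_cvg G Gn add_cvg dn).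
have phic u : 0 < u <= 1 -> phi (psin n) u @[n --> \oo] --> phi psi u.
  by apply: phi_cvg1 => // v; exact: (phi_cvg G Gn add_cvg dn).
have [N cN gdc] := generator_derive_cvg hl pc pnc pn.
have [L [mL Lcube mL1 Lgood]] := exceptional_null G l0 ld lawP lawmu cN.
exists L; split=> // x /Lgood[px s0 ps Ns].
pose s := phi_sum psi x.
exists [set y : 'rV[R]_(m.+2 - l) |
  (forall j, 0 < y ord0 j < 1) /\ ~ N (s + phi_sum_rV psi y)].
split.
- by move=> y [y01 _] j; have /andP[/ltW -> /ltW ->] := y01 j.
- by apply: closure_cube_rV => //; rewrite subn_gt0.
move=> y [y01 Ny].
have y01' j : 0 < y ord0 j <= 1 by have /andP[-> /ltW] := y01 j.
have [i xi] : exists i, tnth x i < 1.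
  apply: contrapT => nx; move: s0; rewrite /phi_sum big1 ?ltxx// => i _.
  have -> : tnth x i = psi 0.
    apply/eqP; rewrite (generator0 G) eq_le; have /andP[_ ->] := px i.
    by rewrite leNgt; apply/negP => xi; apply: nx; exists i.
  by rewrite phiK// (generator0 G).
have sc : phi_sum (psin n) x @[n --> \oo] --> s.
  by apply: phi_sum_cvg => j; exact: phic.
have tc : phi_sum_rV (psin n) y @[n --> \oo] --> phi_sum_rV psi y.
  by apply: phi_sum_cvg => j; exact: phic.
have t0 : 0 <= phi_sum_rV psi y by apply: sumr_ge0 => j _; exact: phi_ge0.
rewrite markov_kernelE//; last 2 first.
- by exists i.
- by move=> r; exact: generator_derive_zero.
suff : generator_derive m.+2 l (psin n)
      (phi_sum (psin n) x + phi_sum_rV (psin n) y) /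
    generator_derive m.+2 l (psin n) (phi_sum (psin n) x) @[n --> \oo] -->
    generator_derive m.+2 l psi (s + phi_sum_rV psi y) /
    generator_derive m.+2 l psi s.
  apply: cvg_trans; apply: near_eq_cvg; near=> n.
  rewrite markov_kernelE//; first by exists i.
  - near: n; apply: (cvgr_gt (psi s)) => //.
    apply: (convex_decr_cvg dn (diff_monotone_convex_decr pc) pn) => //.
  - by move=> r; exact: generator_derive_zero.
apply: cvgM; first by apply: gdc => //; [exact: ltr_wpDr|exact: cvgD].
apply: cvgV; first exact: (generator_derive_neq0 hl pc s0 ps (generator_cvg G)).
exact: gdc.
Unshelve. all: by end_near. Qed.
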